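(* Let $A$ be a noetherian commutative ring in which $2$ is invertible, let $n\ge1$, let $f(u)=\sum_{i=0}^na_{2n-2i}u^{2i}\in A[u]$ with $a_0=1$, let $\alpha\in A$ satisfy $\alpha^2=(-1)^na_{2n}$, let $B$ be the type D splitting ring of $(f,\alpha)$, and let $\bar\Delta\in A$ and $E\subset\operatorname{Spec}(A)$ be as in the context. Suppose that (a) $A$ is normal, (b) $\bar\Delta$ is squarefree and a non-zerodivisor, (c) $E$ has codimension $\ge2$ in $\operatorname{Spec}(A)$. Then $B$ is normal.
   Context: The type D splitting ring is $B=\operatorname{DSplit}_A(f,\alpha)=A[\eta_1,\dots,\eta_n]/I$, where $I$ is generated by $a_{2i}-(-1)^ie_i(\eta_1^2,\dots,\eta_n^2)$ for $1\le i\le n-1$ and $\eta_1\cdots\eta_n-\alpha$ (so that $f(u)=\prod_{i=1}^n(u^2-\eta_i^2)$ in $B[u]$); $e_i$ is the $i$th elementary symmetric polynomial. Let $\tilde\Delta\in A$ be the discriminant of $\sum_{i=0}^na_{2n-2i}v^i$ (a polynomial in $v$). The reduced discriminant of $(f,\alpha)$ is $\bar\Delta=4^n\alpha\tilde\Delta\in A$; in $B$ it equals $4^n\eta_1\cdots\eta_n\prod_{i<j}(\eta_i^2-\eta_j^2)^2$. Consider the $n+\binom n2$ equations on $\operatorname{Spec}(B)$: $\eta_i=0$ for $1\le i\le n$, and $\eta_i^2=\eta_j^2$ for $1\le i<j\le n$. Let $\tilde E\subset\operatorname{Spec}(B)$ be the closed locus where at least two of these equations hold, and $E\subset\operatorname{Spec}(A)$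 its image (closed since $A\to B$ is finite). An element $h$ of a normal ring $R$ is squarefree if $v_{\mathfrak p}(h)\in\{0,1\}$ for all height one primes $\mathfrak p$ of $R$, $v_{\mathfrak p}$ being the associated valuation. A subset of $\operatorname{Spec}(A)$ has codimension $\ge c$ if all primes it contains have height $\ge c$. *)

(* Defs.v *)
From HB Require Import structures.
From mathcomp Require Import all_boot all_algebra ring.
From mathcomp Require Import boolp classical_sets.
From mathcomp Require Import mpoly.

Set Implicit Arguments.
Unset Strict Implicit.
Unset Printing Implicit Defensive.

Import GRing.Theory.

Local Open Scope ring_scope.
Local Open Scope quotient_scope.
Local Open Scope classical_set_scope.

(* Rings are comPzRingType's (possibly zero) wherever the libraries allow;
   polynomial rings need a comNzRingType as coefficient ring. *)

Section Ideals.

Definition is_ideal (R : comPzRingType) (I : set R) : Prop :=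
  [/\ I 0, forall x y, I x -> I y -> I (x + y) & forall a x, I x -> I (a * x)].

Record ideal (R : comPzRingType) := Ideal {
  ideal_mem :> R -> Prop;
  idealP : is_ideal ideal_mem }.

Definition ideal_gen_set (R : comPzRingType) (G : set R) : set R :=
  fun x => forall I : set R, is_ideal I -> G `<=` I -> I x.

Lemma ideal_gen_subproof (R : comPzRingType) (G : set R) :
  is_ideal (ideal_gen_set G).
Proof.
split=> [I [] // | x y Gx Gy I idI sGI | a x Gx I idI sGI].
  by have [_ addI _] := idI; apply: addI; [apply: Gx | apply: Gy].
by have [_ _ mulI] := idI; apply: mulI; apply: Gx.
Qed.

Definition ideal_gen (R : comPzRingType) (G : set R) : ideal R :=
  Ideal (ideal_gen_subproof G).

Definition noetherian (R : comPzRingType) : Prop :=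
  forall I : ideal R, exists s : seq R, forall x, I x <-> ideal_gen [set y | y \in s] x.

Record spec (R : comPzRingType) := Spec {
  prime_of :> ideal R;
  spec_proper : ~ prime_of 1;
  spec_prime : forall x y : R,
    prime_of (x * y) -> prime_of x \/ prime_of y }.

(* [height_ge P k]: there is a chain Q 0 < ... < Q k = P of prime ideals. *)
Definition height_ge (R : comPzRingType) (P : spec R) (k : nat) : Prop :=
  exists Q : nat -> spec R,
    (forall i, (i < k)%N -> [set x | Q i x] `<` [set x | Q i.+1 x]) /\
    (forall x, Q k x <-> P x).

Definition height_one (R : comPzRingType) (P : spec R) : Prop :=
  height_ge P 1 /\ ~ height_ge P 2.

Definition codim_ge (R : comPzRingType) (Z : set (spec R)) (c : nat) : Prop :=
  forall P : spec R, Z P -> height_ge P c.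

Definition invertible (R : comPzRingType) (x : R) : Prop :=
  exists y, x * y = 1.

End Ideals.

(* The library's {ideal_quot I} requires I to be a proper ideal of a nonzero
   ring; [qring I] is the same quotient type, made a comPzRingType for an
   arbitrary ideal. *)
Section QuotientRing.

Variables (R : comPzRingType) (I : ideal R).

Definition ideal_pred : {pred R} := fun x => `[< I x >].

Lemma ideal_pred_zmod : zmod_closed ideal_pred.
Proof.
have [I0 addI mulI] := idealP I.
split=> [|x y /asboolP Ix /asboolP Iy]; first exact/asboolP.
by apply/asboolP; rewrite -mulN1r; apply: addI => //; apply: mulI.
Qed.

HB.instance Definition _ := GRing.isZmodClosed.Build R ideal_pred ideal_pred_zmod.

Definition qring : Type := Quotient.quot (ideal_pred : zmodClosed R).

HB.instance Definition _ := GRing.Zmodule.on qring.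
HB.instance Definition _ := EqQuotient.on qring.

Definition qproj (x : R) : qring := \pi_qring x.

Lemma qproj_eq x y : qproj x = qproj y <-> I (x - y).
Proof.
split=> [/eqP|Ixy].
  by rewrite /qproj -[_ == _]Quotient.idealrBE => /asboolP.
by apply/eqP; rewrite /qproj -[_ == _]Quotient.idealrBE; apply/asboolP.
Qed.

Lemma qproj_surj (z : qring) : exists x, z = qproj x.
Proof. by exists (repr z); rewrite /qproj reprK. Qed.

Definition qone : qring := qproj 1.
Definition qmul (y z : qring) : qring := qproj (repr y * repr z).

Lemma qprojM x y : qproj (x * y) = qmul (qproj x) (qproj y).
Proof.
have [_ addI mulI] := idealP I.
have rE u : I (u - repr (qproj u)) by apply/qproj_eq; rewrite /qproj reprK.
apply/qproj_eq; set x' := repr _; set y' := repr _.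
rewrite (_ : _ - _ = y * (x - x') + x' * (y - y')); last by ring.
by apply: addI; apply: mulI; apply: rE.
Qed.

Lemma qprojD x y : qproj (x + y) = qproj x + qproj y.
Proof. exact: Quotient.pi_add. Qed.

Lemma qmulA : associative qmul.
Proof.
move=> x y z; have [[x' ->] [y' ->] [z' ->]] :=
  And3 (qproj_surj x) (qproj_surj y) (qproj_surj z).
by rewrite -!qprojM mulrA.
Qed.

Lemma qmulC : commutative qmul.
Proof. by move=> x y; rewrite /qmul mulrC. Qed.

Lemma qmul1 : left_id qone qmul.
Proof. by move=> x; have [x' ->] := qproj_surj x; rewrite -qprojM mul1r. Qed.

Lemma qmulDl : left_distributive qmul +%R.
Proof.
move=> x y z; have [[x' ->] [y' ->] [z' ->]] :=
  And3 (qproj_surj x) (qproj_surj y) (qproj_surj z).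
by rewrite -qprojD -!qprojM mulrDl qprojD.
Qed.

HB.instance Definition _ :=
  GRing.Zmodule_isComPzRing.Build qring qmulA qmulC qmul1 qmulDl.

Lemma qproj_zmod_morphism : zmod_morphism qproj.
Proof.
have qB := @Quotient.pi_opp R (ideal_pred : zmodClosed R).
by move=> x y; rewrite qprojD; congr (_ + _); apply: qB.
Qed.

Lemma qproj_monoid_morphism : monoid_morphism qproj.
Proof. by split=> // x y; rewrite qprojM. Qed.

HB.instance Definition _ := GRing.isZmodMorphism.Build R qring qproj qproj_zmod_morphism.
HB.instance Definition _ := GRing.isMonoidMorphism.Build R qring qproj qproj_monoid_morphism.

End QuotientRing.

Record mulset (R : comPzRingType) := MulSet {
  mulset_mem :> R -> Prop;
  mulset0 : ~ mulset_mem 0;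
  mulset1 : mulset_mem 1;
  mulsetM : forall x y, mulset_mem x -> mulset_mem y -> mulset_mem (x * y) }.

Section Localization.

Variables (R : comPzRingType) (S : mulset R).

Definition frac_pair := {x : R * R | `[< S x.2 >]}.
HB.instance Definition _ := Choice.on frac_pair.

Definition fnum (x : frac_pair) : R := (val x).1.
Definition fden (x : frac_pair) : R := (val x).2.

Lemma fdenP x : S (fden x). Proof. by case: x => y /= Sy; apply/asboolP. Qed.

Definition fpair (a s : R) (Ss : S s) : frac_pair :=
  exist (fun x : R * R => `[< S x.2 >] : bool) (a, s) (asboolT Ss).

Lemma fpairK x : fpair (fnum x) (fdenP x) = x.
Proof. by apply: val_inj; case: x => [[a s] Ss]. Qed.

Definition frac_equiv (x y : frac_pair) : bool :=
  `[< exists2 t, S t & t * (fnum x * fden y) = t * (fnum y * fden x) >].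

Lemma frac_equiv_is_equiv : equiv_class_of frac_equiv.
Proof.
split=> [x|x y|y x z].
- by apply/asboolP; exists 1 => //; apply: mulset1.
- by apply: asbool_equiv_eq; split=> -[t St e]; exists t.
move=> /asboolP[t St e1] /asboolP[u Su e2]; apply/asboolP.
exists (t * u * fden y); first by do !apply: mulsetM => //; apply: fdenP.
transitivity (u * fden z * (t * (fnum x * fden y))); first by ring.
rewrite e1; transitivity (t * fden x * (u * (fnum y * fden z))); first by ring.
by rewrite e2; ring.
Qed.

Canonical frac_equiv_equiv := EquivRelPack frac_equiv_is_equiv.
Canonical frac_equiv_encModRel := defaultEncModRel frac_equiv.

Definition loc := {eq_quot frac_equiv}.

HB.instance Definition _ := Choice.on loc.
HB.instance Definition _ := EqQuotient.on loc.

Definition frac (a s : R) (Ss : S s) : loc := \pi_loc (fpair a Ss).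

Lemma frac_eq a s (Ss : S s) b t (St : S t) :
  frac a Ss = frac b St <-> exists2 u, S u & u * (a * t) = u * (b * s).
Proof.
split=> [/eqP|e]; first by rewrite /frac piE => /asboolP.
by apply/eqP; rewrite /frac piE; apply/asboolP.
Qed.

Lemma frac_surj (z : loc) : exists a s (Ss : S s), z = frac a Ss.
Proof.
exists (fnum (repr z)), (fden (repr z)), (fdenP (repr z)).
by rewrite /frac fpairK reprK.
Qed.

Definition ladd (y z : loc) : loc :=
  let y' := repr y in let z' := repr z in
  frac (fnum y' * fden z' + fnum z' * fden y') (mulsetM (fdenP y') (fdenP z')).
Definition lmul (y z : loc) : loc :=
  let y' := repr y in let z' := repr z in
  frac (fnum y' * fnum z') (mulsetM (fdenP y') (fdenP z')).
Definition lopp (y : loc) : loc :=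
  let y' := repr y in frac (- fnum y') (fdenP y').

Lemma repr_frac a s (Ss : S s) :
  exists2 u, S u & u * (a * fden (repr (frac a Ss))) =
                   u * (fnum (repr (frac a Ss)) * s).
Proof.
by apply/(frac_eq a Ss _ (fdenP (repr (frac a Ss)))); rewrite {2}/frac fpairK reprK.
Qed.

Lemma fracD a s (Ss : S s) b t (St : S t) :
  ladd (frac a Ss) (frac b St) = frac (a * t + b * s) (mulsetM Ss St).
Proof.
apply/frac_eq; have [u Su eu] := repr_frac a Ss; have [v Sv ev] := repr_frac b St.
set x := repr _ in eu *; set y := repr _ in ev *.
exists (u * v); first exact: mulsetM.
transitivity (v * t * fden y * (u * (fnum x * s)) +
              u * s * fden x * (v * (fnum y * t))); first by ring.
by rewrite -eu -ev; ring.
Qed.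

Lemma fracM a s (Ss : S s) b t (St : S t) :
  lmul (frac a Ss) (frac b St) = frac (a * b) (mulsetM Ss St).
Proof.
apply/frac_eq; have [u Su eu] := repr_frac a Ss; have [v Sv ev] := repr_frac b St.
set x := repr _ in eu *; set y := repr _ in ev *.
exists (u * v); first exact: mulsetM.
transitivity ((u * (fnum x * s)) * (v * (fnum y * t))); first by ring.
by rewrite -eu -ev; ring.
Qed.

Lemma fracN a s (Ss : S s) : lopp (frac a Ss) = frac (- a) Ss.
Proof.
apply/frac_eq; have [u Su eu] := repr_frac a Ss; exists u => //.
by rewrite !mulNr !mulrN eu.
Qed.

Let S1 := mulset1 S.

Lemma frac_eqW a s (Ss : S s) b t (St : S t) :
  a * t = b * s -> frac a Ss = frac b St.
Proof. by move=> e; apply/frac_eq; exists 1 => //; rewrite e. Qed.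

Lemma laddA : associative ladd.
Proof.
move=> x y z; have [a [s [Ss ->]]] := frac_surj x.
have [b [t [St ->]]] := frac_surj y; have [c [u [Su ->]]] := frac_surj z.
by rewrite !fracD; apply: frac_eqW; ring.
Qed.

Lemma laddC : commutative ladd.
Proof.
move=> x y; have [a [s [Ss ->]]] := frac_surj x.
have [b [t [St ->]]] := frac_surj y.
by rewrite !fracD; apply: frac_eqW; ring.
Qed.

Lemma ladd0 : left_id (frac 0 S1) ladd.
Proof.
move=> x; have [a [s [Ss ->]]] := frac_surj x.
by rewrite !fracD; apply: frac_eqW; ring.
Qed.

Lemma laddN : left_inverse (frac 0 S1) lopp ladd.
Proof.
move=> x; have [a [s [Ss ->]]] := frac_surj x.
by rewrite fracN fracD; apply: frac_eqW; ring.
Qed.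

HB.instance Definition _ := GRing.isZmodule.Build loc laddA laddC ladd0 laddN.

Lemma lmulA : associative lmul.
Proof.
move=> x y z; have [a [s [Ss ->]]] := frac_surj x.
have [b [t [St ->]]] := frac_surj y; have [c [u [Su ->]]] := frac_surj z.
by rewrite !fracM; apply: frac_eqW; ring.
Qed.

Lemma lmulC : commutative lmul.
Proof.
move=> x y; have [a [s [Ss ->]]] := frac_surj x.
have [b [t [St ->]]] := frac_surj y.
by rewrite !fracM; apply: frac_eqW; ring.
Qed.

Lemma lmul1 : left_id (frac 1 S1) lmul.
Proof.
move=> x; have [a [s [Ss ->]]] := frac_surj x.
by rewrite !fracM; apply: frac_eqW; ring.
Qed.

Lemma lmulDl : left_distributive lmul +%R.
Proof.
move=> x y z; have [a [s [Ss ->]]] := frac_surj x.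
have [b [t [St ->]]] := frac_surj y; have [c [u [Su ->]]] := frac_surj z.
rewrite ![_ + _]fracD !fracM [RHS]fracD; apply: frac_eqW; ring.
Qed.

Lemma loc1_neq0 : frac 1 S1 != 0.
Proof.
apply/eqP => /frac_eq[u Su]; rewrite mul0r mulr0 !mulr1 => u0.
by apply: (@mulset0 _ S); rewrite -u0.
Qed.

HB.instance Definition _ :=
  GRing.Zmodule_isComNzRing.Build loc lmulA lmulC lmul1 lmulDl loc1_neq0.

Definition to_loc (a : R) : loc := frac a S1.

Lemma to_loc_zmod_morphism : zmod_morphism to_loc.
Proof.
move=> a b; rewrite /to_loc -[RHS]/(ladd (frac a S1) (lopp (frac b S1))).
by rewrite fracN fracD; apply: frac_eqW; ring.
Qed.

Lemma to_loc_monoid_morphism : monoid_morphism to_loc.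
Proof. by split=> // a b; rewrite [RHS]fracM; apply: frac_eqW; ring. Qed.

HB.instance Definition _ := GRing.isZmodMorphism.Build R loc to_loc to_loc_zmod_morphism.
HB.instance Definition _ := GRing.isMonoidMorphism.Build R loc to_loc to_loc_monoid_morphism.

End Localization.

Section Normality.

Lemma compl_mulset0 (R : comPzRingType) (P : spec R) : ~ ~ P 0.
Proof. by have [P0 _ _] := idealP P; apply. Qed.

Lemma compl_mulsetM (R : comPzRingType) (P : spec R) x y :
  ~ P x -> ~ P y -> ~ P (x * y).
Proof. by move=> Px Py /spec_prime[]. Qed.

Definition compl_mulset (R : comPzRingType) (P : spec R) : mulset R :=
  @MulSet R (fun x => ~ P x) (@compl_mulset0 R P) (@spec_proper R P) (@compl_mulsetM R P).

Definition loc_at (R : comPzRingType) (P : spec R) : comNzRingType :=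
  loc (compl_mulset P).

Lemma regular_mulset0 (R : comNzRingType) : ~ GRing.lreg (0 : R).
Proof. by move=> /(_ 0 1); rewrite !mul0r => /(_ erefl)/esym/eqP; rewrite oner_eq0. Qed.

Definition regular_mulset (R : comNzRingType) : mulset R :=
  @MulSet R (@GRing.lreg R) (@regular_mulset0 R) (@GRing.lreg1 R) (@GRing.lregM R).

(* When D is an integral domain this is its field of fractions. *)
Definition total_frac (D : comNzRingType) : comNzRingType :=
  loc (regular_mulset D).

Definition to_frac (D : comNzRingType) : D -> total_frac D :=
  @to_loc D (regular_mulset D).

Definition normal_domain (D : comNzRingType) : Prop :=
  GRing.integral_domain_axiom D /\
  forall z : total_frac D,
    integralOver (@to_frac D) z -> exists x : D, z = to_frac x.

Definition normal (R : comPzRingType) : Prop :=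
  forall P : spec R, normal_domain (loc_at P).

Definition to_loc_at (R : comPzRingType) (P : spec R) : R -> loc_at P :=
  @to_loc R (compl_mulset P).

Definition max_loc (R : comPzRingType) (P : spec R) : ideal (loc_at P) :=
  ideal_gen (@to_loc_at R P @` [set x | P x]).

(* [valuation_eq P h k]: v_P(h) = k, when the localization at P is a discrete
   valuation ring, as it is for P of height one in a normal noetherian ring;
   [pi] is a uniformizer. For h = 0 in the localization, v_P(h) is infinite and
   [valuation_eq P h k] holds for no k. *)
Definition valuation_eq (R : comPzRingType) (P : spec R) (h : R) (k : nat) :=
  exists pi u : loc_at P,
    [/\ forall z, max_loc P z <-> ideal_gen [set pi] z,
        invertible u & to_loc_at P h = u * pi ^+ k].

Definition squarefree (R : comPzRingType) (h : R) : Prop :=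
  forall P : spec R, height_one P -> valuation_eq P h 0 \/ valuation_eq P h 1.

End Normality.

(* Discriminant of a monic polynomial. With q the derivative of p, the
   library's [resultant q p] puts low-degree coefficients first and is the
   product of the q.[x], x running over the roots of p (with multiplicity),
   whatever the size of q. *)
Definition monic_disc (A : comNzRingType) (p : {poly A}) : A :=
  (-1) ^+ 'C((size p).-1, 2) * resultant p^`() p.

Section TypeD.

Variables (A : comNzRingType) (n : nat) (f : {poly A}) (alpha : A).

(* a_{2i}, the coefficients of f being numbered from the leading one *)
Definition dcoef (i : nat) : A := f`_(2 * n - 2 * i).

Definition esym_sq (i : nat) : {mpoly A[n]} :=
  mesym n A i \mPo [tuple ('X_j : {mpoly A[n]}) ^+ 2 | j < n].

Definition dsplit_rels : set {mpoly A[n]} :=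
  [set (dcoef i)%:MP_[n] - (-1) ^+ i * esym_sq i | i in [set i | (1 <= i <= n.-1)%N]]
  `|` [set \prod_(j < n) 'X_j - alpha%:MP_[n]].

Definition DSplit : comPzRingType := qring (ideal_gen dsplit_rels).

Definition dsplit_map (c : A) : DSplit := qproj (ideal_gen dsplit_rels) c%:MP_[n].

Definition eta (j : 'I_n) : DSplit := qproj (ideal_gen dsplit_rels) 'X_j.

Definition tilde_disc : A := monic_disc (\sum_(i < n.+1) dcoef (n - i) *: 'X^i).

Definition reduced_disc : A := 4 ^+ n * alpha * tilde_disc.

Definition deqn : Type := ('I_n + {ij : 'I_n * 'I_n | (ij.1 < ij.2)%N})%type.

Definition deqn_lhs (e : deqn) : DSplit :=
  match e with
  | inl i => eta i
  | inr ij => eta (val ij).1 ^+ 2 - eta (val ij).2 ^+ 2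
  end.

Definition E_tilde : set (spec DSplit) :=
  [set Q | exists e1 e2 : deqn, [/\ e1 <> e2, Q (deqn_lhs e1) & Q (deqn_lhs e2)]].

Definition E_locus : set (spec A) :=
  [set P | exists2 Q, E_tilde Q & forall c, P c <-> Q (dsplit_map c)].

End TypeD.

(* Main.v *)
(* The group W of signed permutations with an even number of signs acts on B by
   permuting the roots eta_i up to sign.  Adjoining alpha / eta_1 together with
   eta_1 to A, and iterating, B is spanned over A by |W| elements b_j.  Let
   J = prod_(i < j) (eta_i^2 - eta_j^2).  Lagrange interpolation produces an
   element sum_l x_l (x) y_l of B (x)_A B such that sum_l x_l w(y_l) = 0 for every
   w <> 1 in W, and divides a power of J for w = 1.  It follows that det (w(b_j))
   divides a power of the discriminant, so that the b_j form a basis, and B^W = A.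

   If z in B[1/d], with d in A, is integral over B, then
   (sum_l x_l y_l) z = sum_l x_l Tr(y_l z), where the traces are integral over A and
   W-invariant, hence in A: so J^m z is in B, for some m independent of z.  If z is
   not in B, some coordinate of d z generates an ideal of A/d with an associated
   prime P, which has height one because A is normal, and contains the discriminant.
   At P, the discriminant is a uniformizer, alpha is a unit, and each prime Q over P
   that contains J contains exactly one factor eta_i^2 - eta_j^2, hence exactly one
   theta = eta_i +- eta_j; the inertia group of Q has order 2.  Interpolating off the
   inertia group, theta generates Q B_Q, so that B_P / J is reduced.  Since J^m z^2 is
   also in B, one gets J^(m-1) z in B_P as long as m > 0: a contradiction.

   Normality of B at a prime Q follows: monic equations over A yield the
   idempotents that split off the zero divisors of B. *)
From HB Require Import structures.
Require Import Defs.
From mathcomp Require Import all_boot all_algebra monoid perm ring qpoly mpoly.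
From mathcomp Require Import boolp classical_sets.

Set Implicit Arguments.
Unset Strict Implicit.
Unset Printing Implicit Defensive.

Import GRing.Theory.

Local Open Scope ring_scope.

(** * Ideals and associated primes *)

Definition divides (R : comPzRingType) (d x : R) : Prop := exists e, x = d * e.

Section Divides.

Variable R : comPzRingType.
Implicit Types d x y : R.

Lemma divides_refl d : divides d d.
Proof. by exists 1; rewrite mulr1. Qed.

Lemma dividesD d x y : divides d x -> divides d y -> divides d (x + y).
Proof. by move=> [e ->] [e' ->]; exists (e + e'); rewrite mulrDr. Qed.

Lemma dividesMl d x y : divides d x -> divides d (y * x).
Proof. by move=> [e ->]; exists (y * e); rewrite mulrCA. Qed.

Lemma dividesMr d x y : divides d x -> divides d (x * y).
Proof. by move=> dx; rewrite mulrC; apply: dividesMl. Qed.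

Lemma divides_trans d x y : divides d x -> divides x y -> divides d y.
Proof. by move=> dx [e ->]; apply: dividesMr. Qed.

Lemma divides_mul d x d' x' :
  divides d x -> divides d' x' -> divides (d * d') (x * x').
Proof. by move=> [e ->] [e' ->]; exists (e * e'); rewrite mulrACA. Qed.

Lemma divides_exp d x k : divides d x -> divides (d ^+ k) (x ^+ k).
Proof. by move=> [e ->]; exists (e ^+ k); rewrite exprMn. Qed.

Lemma divides0 d : divides d 0.
Proof. by exists 0; rewrite mulr0. Qed.

Lemma divides_sum d (I : Type) (r : seq I) (p : pred I) (F : I -> R) :
  (forall i, p i -> divides d (F i)) -> divides d (\sum_(i <- r | p i) F i).
Proof.
by move=> dF; elim/big_ind: _ => //; [apply: divides0 | apply: dividesD].
Qed.

Lemma divides_ideal d : is_ideal (divides d).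
Proof.
split; [exact: divides0 | exact: dividesD | move=> a x; exact: dividesMl].
Qed.

End Divides.

Section IdealLemmas.

Variable R : comPzRingType.

Lemma ideal0 (I : ideal R) : I 0.
Proof. by have [] := idealP I. Qed.

Lemma idealD (I : ideal R) x y : I x -> I y -> I (x + y).
Proof. by have [_ + _] := idealP I; apply. Qed.

Lemma ideal_mull (I : ideal R) a x : I x -> I (a * x).
Proof. by have [_ _ +] := idealP I; apply. Qed.

Lemma ideal_mulr (I : ideal R) a x : I x -> I (x * a).
Proof. by move=> Ix; rewrite mulrC; apply: ideal_mull. Qed.

Lemma idealN (I : ideal R) x : I x -> I (- x).
Proof. by move=> Ix; rewrite -mulN1r; apply: ideal_mull. Qed.

Lemma idealB (I : ideal R) x y : I x -> I y -> I (x - y).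
Proof. by move=> Ix Iy; apply: idealD => //; apply: idealN. Qed.

Lemma idealDK (I : ideal R) x y : I x -> I (x + y) -> I y.
Proof. by move=> Ix Ixy; rewrite -(addKr x y); apply: idealD => //; apply: idealN. Qed.

Lemma ideal_sum (I : ideal R) (T : Type) (r : seq T) (p : pred T) (F : T -> R) :
  (forall i, p i -> I (F i)) -> I (\sum_(i <- r | p i) F i).
Proof.
by move=> IF; elim/big_ind: _ => //; [apply: ideal0 | move=> ? ?; apply: idealD].
Qed.

Lemma ideal_divides (I : ideal R) d x : I d -> divides d x -> I x.
Proof. by move=> Id [e ->]; apply: ideal_mulr. Qed.

Lemma ideal_gen_seqP (s : seq R) x :
  ideal_gen [set y | y \in s]%classic x <->
  exists c : nat -> R, x = \sum_(i < size s) c i * s`_i.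
Proof.
split=> [|[c ->]]; last first.
  by apply: ideal_sum => i _; apply: ideal_mull => J _; apply; apply: mem_nth.
move/(_ (fun x => exists c : nat -> R, x = \sum_(i < size s) c i * s`_i)); apply.
  split.
  - by exists (fun=> 0); rewrite big1 // => i _; rewrite mul0r.
  - move=> _ _ [c ->] [c' ->]; exists (fun i => c i + c' i).
    by rewrite -big_split; apply: eq_bigr => i _; rewrite mulrDl.
  - move=> a _ [c ->]; exists (fun i => a * c i).
    by rewrite mulr_sumr; apply: eq_bigr => i _; rewrite mulrA.
move=> y /= ys; exists (fun i => (i == index y s)%:R).
have lt : (index y s < size s)%N by rewrite index_mem.
rewrite (bigD1 (Ordinal lt)) //= eqxx mul1r nth_index // big1 ?addr0 // => i.
by rewrite -val_eqE /= => /negPf->; rewrite mul0r.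
Qed.

Lemma ideal_gen_set1 (d x : R) : ideal_gen [set d]%classic x -> divides d x.
Proof.
by apply; [exact: divides_ideal | move=> _ ->; exact: divides_refl].
Qed.

Section Primes.

Variable P : spec R.

Lemma prime_prod (I : finType) (F : I -> R) :
  (forall i, ~ P (F i)) -> ~ P (\prod_i F i).
Proof.
move=> nPF; elim/big_ind: _ => //; first exact: spec_proper.
by move=> x y nPx nPy /spec_prime[].
Qed.

Lemma prime_exp x k : P (x ^+ k) -> P x.
Proof.
elim: k => [|k IHk]; first by rewrite expr0 => /spec_proper.
by rewrite exprS => /spec_prime[].
Qed.

Lemma prime_unit x y : x * y = 1 -> ~ P x.
Proof. by move=> xy Px; apply: (@spec_proper _ P); rewrite -xy; apply: ideal_mulr. Qed.

End Primes.

(** Zorn's lemma for sets also asks for the union of the empty chain. The empty set is therefore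
    added to [F]; it is not maximal, because every ideal contains [0]. *)
Lemma Zorn_ideal (F : set (set R)) :
  (forall X, F X -> is_ideal X) -> (exists X, F X) ->
  (forall C : set (set R), (C `<=` F -> (exists X, C X) ->
     is_ideal (\bigcup_(X in C) X) ->
     (forall X Y, C X -> C Y -> (X `<=` Y) \/ (Y `<=` X)) ->
     F (\bigcup_(X in C) X))%classic) ->
  exists2 X, F X & forall Y, F Y -> (X `<=` Y)%classic -> (Y `<=` X)%classic.
Proof.
move=> idF [X0 FX0] chF.
pose P (X : set R) := X = set0 \/ F X.
have [|A [[A0|FA] maxA]] := @Zorn_bigcup R P.
- move=> C CP totC.
  have [[X [CX FX]]|noF] := pselect (exists X, C X /\ F X); last first.
    left; apply/seteqP; split=> // x [X CX Xx].
    by have [X0'|FX] := CP X CX; [rewrite X0' in Xx | case: noF; exists X].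
  right; pose C' : set (set R) := fun X => C X /\ F X.
  have -> : (\bigcup_(X in C) X = \bigcup_(X in C') X)%classic.
    apply/seteqP; split=> x [Y CY Yx]; last by exists Y => //; case: CY.
    by exists Y => //; split=> //; have [Y0|//] := CP Y CY; rewrite Y0 in Yx.
  have tot' X1 X2 : C' X1 -> C' X2 -> ((X1 `<=` X2) \/ (X2 `<=` X1))%classic.
    by move=> [C1 _] [C2 _]; apply: totC.
  apply: chF => //; [by move=> ? [] | by exists X | split].
  + by exists X => //; have [] := idF X FX.
  + move=> x y [X1 C1 X1x] [X2 C2 X2y].
    have [s12|s21] := tot' _ _ C1 C2.
      by exists X2 => //; have [_ + _] := idF _ C2.2; apply=> //; apply: s12.
    by exists X1 => //; have [_ + _] := idF _ C1.2; apply=> //; apply: s21.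
  + by move=> a x [Y CY Yx]; exists Y => //; have [_ _ +] := idF _ CY.2; apply.
- suff /maxA : (A `<` X0)%classic by case; right.
  by rewrite A0; split=> // /(_ 0); apply; have [] := idF _ FX0.
exists A => // Y FY AY x Yx; apply: contrapT => nAx.
suff /maxA : (A `<` Y)%classic by case; right.
by split=> // YA; apply/nAx/YA.
Qed.

(** An ideal maximal among those that contain [I] and miss [S] is prime: adjoining either of two
    elements outside it creates an element of [S], and the product of the two elements so created
    would lie in the ideal if the product of the given ones did. *)
Lemma prime_avoiding (I : ideal R) (S : R -> Prop) :
  S 1 -> (forall x y, S x -> S y -> S (x * y)) -> (forall x, I x -> ~ S x) ->
  exists2 P : spec R, (forall x, I x -> P x) & forall x, P x -> ~ S x.
Proof.
move=> S1 SM IS.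
pose F (X : set R) := [/\ is_ideal X, forall x, I x -> X x & forall x, X x -> ~ S x].
have [X []|||X [idX IX XS] maxX] := @Zorn_ideal F => //.
- by exists I; split=> //; apply: idealP.
- move=> C CF [X CX] idU totC; split=> // x.
    by exists X => //; have [_ + _] := CF X CX; apply.
  by case=> Y CY Yx; have [_ _] := CF Y CY; apply.
pose PX := Ideal idX.
have [X0 XD XM] := idX.
have meetS a : ~ X a -> exists x b, X x /\ S (x + b * a).
  move=> nXa; apply: contrapT => noS; apply: nXa.
  pose Y : set R := fun y => exists x b, X x /\ y = x + b * a.
  apply: (maxX Y); last by exists 0, 1; split; rewrite ?add0r ?mul1r.
    split; [split | move=> x /IX Xx | move=> _ [x [b [Xx ->]]] Sx].
    + by exists 0, 0; split; rewrite ?mul0r ?addr0.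
    + move=> _ _ [x [b [Xx ->]]] [x' [b' [Xx' ->]]]; exists (x + x'), (b + b').
      by split; [apply: XD | rewrite mulrDl addrACA].
    + move=> c _ [x [b [Xx ->]]]; exists (c * x), (c * b).
      by split; [apply: XM | rewrite mulrDr mulrA].
    + by exists x, 0; split; rewrite ?mul0r ?addr0.
    + by apply: noS; exists x, b.
  by move=> x Xx; exists x, 0; split; rewrite ?mul0r ?addr0.
have prX x y : PX (x * y) -> PX x \/ PX y.
  move=> /= Xxy; apply: contrapT => /not_orP[/meetS[u [b [Xu Sa]]] /meetS[v [c [Xv Sb]]]].
  apply: (XS _ _ (SM _ _ Sa Sb)).
  have -> : (u + b * x) * (v + c * y) = (v + c * y) * u + b * x * v + b * c * (x * y).
    by ring.
  by apply: (XD); [apply: XD|]; apply: XM.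
have pX : ~ PX 1 by move=> X1; apply: (XS 1).
by exists (Spec pX prX) => x; [apply: IX | apply: XS].
Qed.

(** The passage from local to global: [I] will be an annihilator, a colon ideal, or the sum of an
    ideal and its annihilator. *)
Lemma ideal_full (I : ideal R) : (forall P : spec R, exists2 x, I x & ~ P x) -> I 1.
Proof.
move=> nP; apply: contrapT => nI1.
have [//|_ _ -> ->|x Ix x1|P IP _] := @prime_avoiding I [set 1]%classic.
- by rewrite mulr1.
- by apply: nI1; rewrite -x1.
by have [x /IP] := nP P.
Qed.

Lemma nilpotent_of_primes x : (forall P : spec R, P x) -> exists k, x ^+ k = 0.
Proof.
move=> Px; apply: contrapT => nx.
have id0 : is_ideal (fun y : R => y = 0).
  by split=> // [_ _ -> ->|a _ ->]; rewrite ?addr0 ?mulr0.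
have [|||P _ PS] := @prime_avoiding (Ideal id0) (fun y => exists k, y = x ^+ k).
- by exists 0%N.
- by move=> _ _ [k ->] [l ->]; exists (k + l)%N; rewrite exprD.
- by move=> _ /= -> [k k0]; apply: nx; exists k.
by apply: (PS x (Px P)); exists 1%N.
Qed.

(** The union of a chain is finitely generated, its generators lie in one member of the chain, and
    that member is the union. *)
Lemma noetherian_max (F : set (set R)) : noetherian R ->
  (forall X, F X -> is_ideal X) -> (exists X, F X) ->
  exists2 X, F X & forall Y, F Y -> (X `<=` Y)%classic -> (Y `<=` X)%classic.
Proof.
move=> noeR idF exF; apply: Zorn_ideal => // C CF [X0 CX0] idU totC.
have [s Us] := noeR (Ideal idU).
have [X CX sX] : exists2 X, C X & forall y, y \in s -> X y.
  have : forall y, y \in s -> exists2 X, C X & X y.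
    move=> y ys; have : Ideal idU y by apply/Us => J _; apply.
    by case=> X CX Xy; exists X.
  elim: (s) => [|y s' IHs] exC; first by exists X0.
  have [|X CX sX] := IHs; first by move=> z zs; apply: exC; rewrite inE zs orbT.
  have [|Y CY Yy] := exC y; first by rewrite mem_head.
  have [XY|YX] := totC _ _ CX CY.
    by exists Y => // z /[!inE] /orP[/eqP->//|/sX/XY].
  by exists X => // z /[!inE] /orP[/eqP->//|/sX//]; apply: YX.
rewrite (_ : (\bigcup_(X in C) X)%classic = X); first exact: CF.
apply/seteqP; split=> [x|x Xx]; last by exists X.
by move=> /(Us x); apply=> //; apply: idF; apply: CF.
Qed.

Definition colon (d c : R) : set R := fun x => divides d (x * c).

Lemma colon_ideal d c : is_ideal (colon d c).
Proof.
rewrite /colon; split=> [|x y xd yd|a x xd].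
- by rewrite mul0r; apply: divides0.
- by rewrite mulrDl; apply: dividesD.
- by rewrite -mulrA; apply: dividesMl.
Qed.

(** A maximal one among the proper ideals [colon d (y * c)] is prime: if it contains [a * b] but not
    [b], then [colon d (b * y * c)] is proper, contains it and contains [a]. *)
Lemma associated_prime (d c : R) : noetherian R -> ~ divides d c ->
  exists (P : spec R) (y : R), ~ divides d (y * c) /\
    forall x, P x <-> divides d (x * (y * c)).
Proof.
move=> noeR ndc.
pose F (X : set R) := exists2 y, ~ divides d (y * c) & X = colon d (y * c).
have [||_ [y ndy ->] maxX] := @noetherian_max F noeR.
- by move=> _ [y _ ->]; apply: colon_ideal.
- by exists (colon d (1 * c)), 1; rewrite ?mul1r.
have proper : ~ Ideal (colon_ideal d (y * c)) 1 by rewrite /= /colon mul1r.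
have prime a b : Ideal (colon_ideal d (y * c)) (a * b) ->
    Ideal (colon_ideal d (y * c)) a \/ Ideal (colon_ideal d (y * c)) b.
  move=> /= abP; have [bP|nbP] := pselect (divides d (b * (y * c))); first by right.
  left; apply: (maxX (colon d (b * y * c))).
  - by exists (b * y) => //; rewrite -mulrA.
  - by move=> x; rewrite /colon -mulrA !(mulrCA x b) => ?; apply: dividesMl.
  - by move: abP; rewrite /colon -!mulrA.
by exists (Spec proper prime), y.
Qed.

End IdealLemmas.

(** * Normality without denominators *)

HB.instance Definition _ (R : comPzRingType) (P : spec R) :=
  GRing.RMorphism.copy (@to_loc_at R P) (@to_loc R (compl_mulset P)).
HB.instance Definition _ (D : comNzRingType) :=
  GRing.RMorphism.copy (@to_frac D) (@to_loc D (regular_mulset D)).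

(* The equation saying that the fraction [x / d] is integral over [R], cleared
   of denominators. *)
Definition integral_quotient (R : comPzRingType) (d x : R) : Prop :=
  exists (k : nat) (r : nat -> R),
    x ^+ k = \sum_(i < k) r i * d ^+ (k - i) * x ^+ i.

Lemma integral_quotient_rmorph (R S : comPzRingType) (h : {rmorphism R -> S}) d x :
  integral_quotient d x -> integral_quotient (h d) (h x).
Proof.
move=> [k [r e]]; exists k, (h \o r); rewrite -rmorphXn e rmorph_sum.
by apply: eq_bigr => i _; rewrite !rmorphM !rmorphXn.
Qed.

Lemma integral_quotient_scale (R : comPzRingType) (c d x : R) :
  integral_quotient d x -> integral_quotient (c * d) (c * x).
Proof.
move=> [k [r e]]; exists k, r; rewrite exprMn e mulr_sumr.
apply: eq_bigr => i _; rewrite !exprMn.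
have -> : c ^+ k = c ^+ (k - i) * c ^+ i by rewrite -exprD subnK // ltnW.
by ring.
Qed.

Lemma integral_quotient_weaken (R : comPzRingType) (c d x : R) :
  integral_quotient (c * d) x -> integral_quotient d x.
Proof.
move=> [k [r e]]; exists k, (fun i => r i * c ^+ (k - i)).
by rewrite e; apply: eq_bigr => i _; rewrite exprMn mulrA.
Qed.

(** A monic equation for [z], multiplied by [h d ^+ k], is an equation for [h x = h d * z].
    Regularity of [h d] allows the way back to [z], injectivity of [h] the descent to [R]. *)
Lemma integral_quotientP (R K : comNzRingType) (h : {rmorphism R -> K})
    (d x : R) (z : K) :
  injective h -> GRing.lreg (h d) -> h d * z = h x ->
  integral_quotient d x <-> integralOver h z.
Proof.
move=> injh regd dz; split=> [[k [r e]]|[p mon_p /rootP pz0]].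
  exists ('X^k - \poly_(i < k) r i).
    rewrite monicE lead_coefDl ?lead_coefXn // size_polyXn size_polyN.
    by rewrite ltnS size_poly.
  apply/rootP; apply: (@lregX _ _ k regd); rewrite mulr0.
  rewrite rmorphB /= map_polyXn hornerD hornerN hornerXn mulrBr -exprMn dz.
  have -> : h x ^+ k = \sum_(i < k) h (r i * d ^+ (k - i) * x ^+ i).
    by rewrite -rmorphXn e rmorph_sum.
  rewrite (@horner_coef_wide _ k); last first.
    by rewrite (leq_trans (size_poly _ _)) // size_poly.
  rewrite mulr_sumr -sumrB big1 // => i _.
  rewrite coef_map coef_poly ltn_ord !rmorphM !rmorphXn -dz exprMn.
  have -> : h d ^+ k = h d ^+ (k - i) * h d ^+ i by rewrite -exprD subnK // ltnW.
  by ring.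
pose k := (size p).-1; exists k, (fun i => - p`_i).
have szp : size p = k.+1 by rewrite prednK // size_poly_gt0 monic_neq0.
apply: injh; rewrite rmorphXn -dz rmorph_sum exprMn.
have : h d ^+ k * (map_poly h p).[z] = 0 by rewrite pz0 mulr0.
rewrite horner_coef size_map_poly_id0; last first.
  by rewrite (monicP mon_p) rmorph1 oner_eq0.
rewrite szp big_ord_recr mulrDr coef_map -/k.
have -> : p`_k = 1 by rewrite /k -lead_coefE (monicP mon_p).
rewrite /= rmorph1 mul1r => /eqP; rewrite addrC addr_eq0 => /eqP ->.
rewrite mulr_sumr -sumrN; apply: eq_bigr => i _.
rewrite coef_map !rmorphM rmorphN !rmorphXn -dz exprMn.
have -> : h d ^+ k = h d ^+ (k - i) * h d ^+ i by rewrite -exprD subnK // ltnW.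
by ring.
Qed.

Lemma to_frac_inj (D : comNzRingType) : injective (@to_frac D).
Proof.
move=> x y /frac_eq[u regu]; rewrite !mulr1; exact: regu.
Qed.

Lemma to_frac_lreg (D : comNzRingType) (d : D) :
  GRing.lreg d -> GRing.lreg (to_frac d).
Proof.
move=> regd y z.
have [a [s [Ss ->]]] := frac_surj y; have [b [t [St ->]]] := frac_surj z.
rewrite [LHS]fracM [RHS]fracM => /frac_eq[u regu]; rewrite !mul1r => /regu e.
by apply/frac_eq; exists 1; [exact: lreg1 | apply: regd; rewrite !mul1r !mulrA].
Qed.

Lemma frac_exists (D : comNzRingType) (d x : D) :
  GRing.lreg d -> exists z, to_frac d * z = to_frac x.
Proof.
move=> regd; exists (@Defs.frac _ (regular_mulset D) x d regd).
by rewrite [LHS]fracM; apply: frac_eqW; rewrite mulr1 mul1r mulrC.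
Qed.

Lemma integral_quotient_mul (R : comNzRingType) (d x d' x' : R) :
  GRing.lreg d -> GRing.lreg d' -> integral_quotient d x -> integral_quotient d' x' ->
  integral_quotient (d * d') (x * x').
Proof.
move=> reg reg'; have [z dz] := frac_exists x reg; have [z' dz'] := frac_exists x' reg'.
move=> /(integral_quotientP (@to_frac_inj _) (to_frac_lreg reg) dz) intz.
move=> /(integral_quotientP (@to_frac_inj _) (to_frac_lreg reg') dz') intz'.
apply/(integral_quotientP (@to_frac_inj _) (to_frac_lreg (lregM reg reg')) (z := z * z')).
  by rewrite !rmorphM /= -dz -dz' mulrACA.
exact: integral_mul.
Qed.

(** * Vanishing and divisibility in a localization, in terms of the ring itself *)

Definition zero_at (R : comPzRingType) (P : spec R) (x : R) : Prop :=
  exists2 s, ~ P s & s * x = 0.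

Definition divides_at (R : comPzRingType) (P : spec R) (d x : R) : Prop :=
  exists2 s, ~ P s & divides d (s * x).

Section Fractions.

Variables (R : comPzRingType) (P : spec R).

Lemma to_loc_at_eq0 x : to_loc_at P x = 0 <-> zero_at P x.
Proof.
split=> [/frac_eq[u nPu]|[s nPs sx]]; first by rewrite mulr1 mul0r mulr0; exists u.
by apply/frac_eq; exists s => //; rewrite mulr1 mul0r mulr0.
Qed.

Lemma to_loc_atP (z : loc_at P) :
  exists (a s : R), ~ P s /\ z * to_loc_at P s = to_loc_at P a.
Proof.
have [a [s [nPs ->]]] := frac_surj z; exists a, s; split=> //.
by rewrite [LHS]fracM; apply: frac_eqW; rewrite !mulr1.
Qed.

Lemma zero_at_ideal : is_ideal (zero_at P).
Proof.
split=> [|x y [s nPs sx] [t nPt ty]|a x [s nPs sx]].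
- by exists 1; [exact: spec_proper | rewrite mulr0].
- exists (s * t); first by case/spec_prime.
  by rewrite mulrDr mulrAC sx mul0r -mulrA ty mulr0 addr0.
- by exists s => //; rewrite mulrCA sx mulr0.
Qed.

Lemma zero_atW x : zero_at P x -> P x.
Proof.
by move=> [s nPs sx]; have /spec_prime[] : P (s * x) by rewrite sx; apply: ideal0.
Qed.

Lemma divides_at_cancel s d x : ~ P s -> divides_at P d (s * x) -> divides_at P d x.
Proof.
move=> nPs [t nPt tsx]; exists (t * s); last by rewrite -mulrA.
by case/spec_prime.
Qed.

Lemma divides_at_ideal d : is_ideal (divides_at P d).
Proof.
split=> [|x y [s nPs dx] [t nPt dy]|a x [s nPs dx]].
- by exists 1; [exact: spec_proper | rewrite mulr0; apply: divides0].
- exists (s * t); first by case/spec_prime.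
  by rewrite mulrDr; apply: dividesD; [rewrite mulrAC|rewrite -mulrA];
    [apply: dividesMr|apply: dividesMl].
- by exists s => //; rewrite mulrCA; apply: dividesMl.
Qed.

Lemma divides_atW d x : divides d x -> divides_at P d x.
Proof. by move=> dx; exists 1; [exact: spec_proper | rewrite mul1r]. Qed.

Lemma loc_at_unit (s : R) : ~ P s -> exists si, to_loc_at P s * si = 1.
Proof.
move=> nPs; exists (@Defs.frac _ (compl_mulset P) 1 s nPs).
by rewrite [LHS]fracM; apply: frac_eqW; rewrite !mulr1 !mul1r.
Qed.

Lemma loc_at_domainP :
  GRing.integral_domain_axiom (loc_at P) <->
  forall x y, zero_at P (x * y) -> zero_at P x \/ zero_at P y.
Proof.
split=> [dom x y /to_loc_at_eq0|dom u v uv0].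
  by rewrite rmorphM => /dom/orP[]/eqP/to_loc_at_eq0; [left|right].
have [a [s [nPs ua]]] := to_loc_atP u; have [b [t [nPt vb]]] := to_loc_atP v.
have unitP (w : loc_at P) (r c : R) : ~ P r -> w * to_loc_at P r = to_loc_at P c ->
    zero_at P c -> w == 0.
  move=> nPr wc /to_loc_at_eq0 c0; apply/eqP.
  have [ri rri] := loc_at_unit nPr.
  by rewrite -[w]mulr1 -rri mulrA wc c0 mul0r.
have /dom[/(unitP u s a nPs ua)->|/(unitP v t b nPt vb)->] : zero_at P (a * b);
  rewrite ?orbT //.
by apply/to_loc_at_eq0; rewrite rmorphM /= -ua -vb mulrACA uv0 mul0r.
Qed.

Local Notation l := (to_loc_at P).

(** Denominators are cleared in three stages: those of the fraction itself, those of the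
    coefficients of its integral equation, and a factor [w] that turns an equality in the
    localization into one in [R]. *)
Lemma normal_domain_loc_at :
  (forall x y, zero_at P (x * y) -> zero_at P x \/ zero_at P y) ->
  (forall d x, ~ zero_at P d -> integral_quotient d x -> divides_at P d x) ->
  normal_domain (loc_at P).
Proof.
move=> /loc_at_domainP dom closed; split=> // z intz.
have [u [v [regv ez]]] := frac_surj z.
have vz : to_frac v * z = to_frac u.
  by rewrite ez [LHS]fracM; apply: frac_eqW; rewrite mulr1 mul1r mulrC.
have [a [s [nPs ua]]] := to_loc_atP u; have [b [t [nPt vb]]] := to_loc_atP v.
have ints : integral_quotient v u.
  by apply/(integral_quotientP (@to_frac_inj _) (to_frac_lreg regv) vz).
have [k [r e]] : integral_quotient (l (s * b)) (l (t * a)).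
  have [-> ->] : l (s * b) = l (s * t) * v /\ l (t * a) = l (s * t) * u.
    by rewrite !rmorphM /= -ua -vb; split; ring.
  exact: integral_quotient_scale.
have nPst : ~ P (s * t) by case/spec_prime.
have [D [nPD DE]] : exists (D : R), ~ P D /\ forall i, (i < k)%N ->
    exists c, l D * r i = l c.
  elim: (k) => [|m [D [nPD IHD]]]; first by exists 1; split=> //; apply: spec_proper.
  have [c [q [nPq rc]]] := to_loc_atP (r m).
  exists (D * q); split; first by case/spec_prime.
  move=> i; rewrite ltnS leq_eqVlt => /orP[/eqP->|/IHD[c' ec']].
    by exists (D * c); rewrite !rmorphM /= -rc; ring.
  by exists (q * c'); rewrite !rmorphM /= -ec'; ring.
have [c cE] : exists c : nat -> R, forall i, (i < k)%N -> l D * r i = l (c i).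
  have /choice[c cE] : forall i, exists x, (i < k)%N -> l D * r i = l x.
    by move=> i; have [/DE[x]|] := boolP (i < k)%N; [exists x | exists 0].
  by exists c.
(* Multiplying a root by [D] multiplies the coefficient of index [i] by [D ^+ (k - i)]; one factor
   [D] clears the denominator of [r i], and [D ^+ (k - i.+1)] remains. *)
pose x0 := D * (t * a); pose y0 := s * b.
have /to_loc_at_eq0[w nPw we] :
    l (x0 ^+ k - \sum_(i < k) (c i * D ^+ (k - i.+1)) * y0 ^+ (k - i) * x0 ^+ i) = 0.
  rewrite rmorphB rmorphXn rmorphM exprMn e mulr_sumr rmorph_sum -sumrB big1 // => i _.
  rewrite !(rmorphM, rmorphXn) /= -cE // exprMn.
  have -> : l D ^+ k = l D ^+ (k - i.+1) * l D * l D ^+ i.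
    by rewrite -exprSr -exprD subnSK // subnK // ltnW.
  by rewrite [(l D * _) ^+ i]exprMn; ring.
have int0 : integral_quotient y0 (w * x0).
  (* For [k = 0] the equation reads [1 = 0] and forces [w = 0]; an equation of degree one replaces
     it. *)
  case: (posnP k) => [k0|k_gt0].
    exists 1%N, (fun=> 0); rewrite big1 ?expr1; last by move=> i _; rewrite !mul0r.
    have w0 : w = 0 by move: we; rewrite k0 big_ord0 expr0 subr0 mulr1.
    by rewrite w0 mul0r.
  exists k, (fun i => c i * D ^+ (k - i.+1) * w ^+ (k - i)).
  move: we; rewrite mulrBr => /eqP; rewrite subr_eq0 => /eqP we.
  have -> : (w * x0) ^+ k = w ^+ k.-1 * (w * x0 ^+ k).
    by rewrite exprMn mulrA -exprSr prednK.
  rewrite we mulrA -exprSr prednK // mulr_sumr; apply: eq_bigr => i _.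
  have -> : w ^+ k = w ^+ (k - i) * w ^+ i by rewrite -exprD subnK // ltnW.
  by rewrite [(w * x0) ^+ i]exprMn; ring.
have nz0 : ~ zero_at P y0.
  move/to_loc_at_eq0 => y00; have /eqP : v = 0.
    have [ti tti] := loc_at_unit nPst.
    rewrite -[v]mulr1 -tti mulrA.
    have -> : v * to_loc_at P (s * t) = to_loc_at P y0.
      by rewrite /y0 !rmorphM /= -vb; ring.
    by rewrite y00 mul0r.
  by move=> /eqP v0; apply: (@regular_mulset0 (loc_at P)); rewrite -v0.
have [q nPq [g ge]] := closed _ _ nz0 int0.
have nPqw : ~ P (q * (w * D)).
  by case/spec_prime => // /spec_prime[].
have [qi qqi] := loc_at_unit nPqw.
exists (l g * qi); apply: (to_frac_lreg regv); rewrite vz -rmorphM; congr to_frac.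
have [ti tti] := loc_at_unit nPst.
have : l (q * (w * x0)) = l (y0 * g) by rewrite ge.
have -> : l (q * (w * x0)) = l (q * (w * D)) * (l (s * t) * u).
  by rewrite /x0 !rmorphM /= -ua; ring.
have -> : l (y0 * g) = l (s * t) * v * l g by rewrite /y0 !rmorphM /= -vb; ring.
move=> E; rewrite -[u]mulr1 -tti -[u * _]mulr1 -qqi.
transitivity (l (q * (w * D)) * (l (s * t) * u) * qi * ti); first by ring.
rewrite E; transitivity (l (s * t) * ti * (v * (l g * qi))); first by ring.
by rewrite tti mul1r.
Qed.

End Fractions.

Section Normal.

Variables (R : comPzRingType) (normR : normal R).

Lemma normal_zero_at (P : spec R) x y :
  zero_at P (x * y) -> zero_at P x \/ zero_at P y.
Proof. by have [/loc_at_domainP dom _] := normR P; apply: dom. Qed.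

Lemma normal_zero_at_exp (P : spec R) x k : zero_at P (x ^+ k) -> zero_at P x.
Proof.
elim: k => [|k IHk]; last by rewrite exprS => /normal_zero_at[].
by rewrite expr0 => /zero_atW/spec_proper.
Qed.

Lemma normal_reduced (x : R) k : x ^+ k = 0 -> x = 0.
Proof.
move=> xk; have idA : is_ideal (fun s : R => s * x = 0).
  split=> [|s t sx tx|a s sx]; first by rewrite mul0r.
  - by rewrite mulrDl sx tx addr0.
  - by rewrite -mulrA sx mulr0.
rewrite -[x]mul1r; apply: (@ideal_full _ (Ideal idA)) => P /=.
have [|s nPs sx] := @normal_zero_at_exp P x k; last by exists s.
by exists 1; [exact: spec_proper | rewrite mul1r].
Qed.

Lemma normal_divides_at (P : spec R) d x :
  ~ zero_at P d -> integral_quotient d x -> divides_at P d x.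
Proof.
move=> nz int; have [dom closed] := normR P.
have regd : GRing.lreg (to_loc_at P d).
  move=> u v /eqP; rewrite -subr_eq0 -mulrBr => /eqP/dom; rewrite subr_eq0.
  by case/orP=> /eqP // /to_loc_at_eq0.
have [z ez] := frac_exists (to_loc_at P x) regd.
have /closed[w zw] : integralOver (@to_frac (loc_at P)) z.
  apply/(integral_quotientP (@to_frac_inj _) (to_frac_lreg regd) ez).
  exact: integral_quotient_rmorph.
have [a [s [nPs wa]]] := to_loc_atP w.
have : to_loc_at P (s * x - d * a) = 0.
  apply/eqP; rewrite rmorphB subr_eq0; apply/eqP.
  rewrite !rmorphM /= -wa mulrA mulrC; congr (_ * _); apply: to_frac_inj.
  by rewrite rmorphM /= -zw ez.
move/to_loc_at_eq0 => [t nPt e]; exists (t * s); first by case/spec_prime.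
by exists (t * a); apply/eqP; rewrite mulrCA -subr_eq0 -mulrA -mulrBr e.
Qed.

Lemma normal_divides (d x : R) : GRing.lreg d -> integral_quotient d x -> divides d x.
Proof.
move=> regd int; rewrite -[x]mul1r.
apply: (@ideal_full _ (Ideal (colon_ideal d x))) => P.
have [[s nPs sd]|s nPs dx] := @normal_divides_at P d x _ int; last by exists s.
case: nPs; suff -> : s = 0 by apply: ideal0.
by apply: regd; rewrite mulr0 mulrC.
Qed.

End Normal.

(** * Height one primes *)

Lemma det_annihilates (R : comNzRingType) (n : nat) (M : 'M[R]_n) (v : 'cV[R]_n) i :
  M *m v = 0 -> \det M * v i 0 = 0.
Proof.
move=> Mv; have : (\det M)%:M *m v = 0 by rewrite -mul_adj_mx -mulmxA Mv mulmx0.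
by rewrite mul_scalar_mx => /matrixP/(_ i 0); rewrite !mxE.
Qed.

Lemma horner_char_poly (R : comNzRingType) (n : nat) (M : 'M[R]_n) (z : R) :
  (char_poly M).[z] = \det (z%:M - M).
Proof.
rewrite -/(horner_eval z _) /char_poly -det_map_mx; congr (\det _).
by apply/matrixP=> i j; rewrite !mxE rmorphB rmorphMn /= /horner_eval hornerX hornerC.
Qed.

(** The determinant is [d ^+ n] times the value at [x / d] of the characteristic polynomial of [M],
    which is monic. *)
Lemma integral_quotient_det (R : comNzRingType) (n : nat) (M : 'M[R]_n) (d x : R) :
  GRing.lreg d -> \det (x%:M - d *: M) = 0 -> integral_quotient d x.
Proof.
move=> regd det0; have [z dz] := frac_exists x regd.
apply/(integral_quotientP (@to_frac_inj _) (to_frac_lreg regd) dz).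
exists (char_poly M); first exact: char_poly_monic.
have regdn := @lregX _ _ n (to_frac_lreg regd).
apply/rootP; rewrite map_char_poly horner_char_poly; apply: regdn.
rewrite mulr0 -detZ -[RHS](rmorph0 (@to_frac R)) -[in RHS]det0 -det_map_mx.
congr (\det _); apply/matrixP=> i j; rewrite !mxE rmorphB rmorphM rmorphMn /= -dz.
by rewrite mulrBr mulrnAr.
Qed.

(** Valuation zero would make [h] a unit at [P], so [h] is a unit times a generator of the maximal
    ideal. *)
Lemma squarefree_uniformizer (R : comPzRingType) (h : R) (P : spec R) :
  squarefree h -> height_one P -> P h -> forall x, P x -> divides_at P h x.
Proof.
move=> sqf ht1 Ph x Px.
have [[pi [u [_ [v uv] hE]]]|[pi [u [maxE [v uv] hE]]]] := sqf P ht1.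
  have [a [s [nPs va]]] := to_loc_atP v; case: nPs.
  have /to_loc_at_eq0[t nPt] : to_loc_at P (h * a - s) = 0.
    apply/eqP; rewrite rmorphB rmorphM /= subr_eq0 -va hE expr0 mulr1 mulrA uv mul1r //.
  rewrite mulrBr => /eqP; rewrite subr_eq0 => /eqP e.
  have /spec_prime[//|//] : P (t * s) by rewrite -e; apply/ideal_mull/ideal_mulr.
have /maxE/ideal_gen_set1[r xr] : max_loc P (to_loc_at P x).
  by move=> J _; apply; exists x.
have [a [s [nPs ra]]] := to_loc_atP (v * r).
have /to_loc_at_eq0[t nPt] : to_loc_at P (s * x - h * a) = 0.
  apply/eqP; rewrite rmorphB !rmorphM /= subr_eq0 -ra hE expr1 xr; apply/eqP.
  by transitivity (to_loc_at P s * (pi * r) * (u * v)); [rewrite uv mulr1 | ring].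
rewrite mulrBr => /eqP; rewrite subr_eq0 => /eqP e.
exists (t * s); first by case/spec_prime.
by exists (t * a); rewrite -mulrA e mulrCA.
Qed.

Section NoetherianNormal.

Variables (R : comNzRingType) (noeR : noetherian R) (normR : normal R).

(** The idempotent cuts out the component of the spectrum through [P]. Let [I] be the kernel of
    localization at [P]. If a prime [M] contains [I], each generator of [I] vanishes at [M], because
    the local ring at [M] is a domain; so some element outside [M] annihilates [I]. Hence [I] and
    its annihilator generate the unit ideal, and [e] is the annihilator part of [1]. *)
Lemma component_idempotent (P : spec R) :
  exists e, [/\ ~ P e, e * (1 - e) = 0 & forall x, zero_at P x -> e * x = 0].
Proof.
pose I := Ideal (zero_at_ideal P); have [s Is] := noeR I.
pose C : set R := fun x => exists a b, [/\ zero_at P a, forall y, I y -> b * y = 0 & x = a + b].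
have idC : is_ideal C.
  split=> [|_ _ [a [b [a0 bI ->]]] [a' [b' [a0' bI' ->]]]|c _ [a [b [a0 bI ->]]]].
  - by exists 0, 0; split=> [|y|]; [exact: (ideal0 I) | rewrite mul0r | rewrite addr0].
  - exists (a + a'), (b + b'); split; [exact: (@idealD _ I) | | ring].
    by move=> y Iy; rewrite mulrDl bI ?bI' ?addr0.
  - exists (c * a), (c * b); split; [exact: (@ideal_mull _ I) | | ring].
    by move=> y Iy; rewrite -mulrA bI ?mulr0.
have [a [b [[t nPt ta] bI e1]]] : Ideal idC 1.
  apply: ideal_full => M; apply: contrapT => noM.
  have CM x : C x -> M x by move=> Cx; apply: contrapT => nMx; apply: noM; exists x.
  have IM x : I x -> M x.
    by move=> Ix; apply: CM; exists x, 0; split=> [//|y _|]; rewrite ?mul0r ?addr0.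
  have [u nMu us] : exists2 u, ~ M u & forall x, x \in s -> u * x = 0.
    have : forall x, x \in s -> I x by move=> x xs; apply/Is => J _; apply.
    elim: (s) => [|x s' IHs] sI; first by exists 1; [exact: spec_proper|].
    have [|u nMu us] := IHs; first by move=> y ys; apply: sI; rewrite inE ys orbT.
    have [q nPq qx] := sI x (mem_head _ _).
    have [|[v nMv vq]|[v nMv vx]] := @normal_zero_at _ normR M q x.
    - by rewrite qx; apply: (@ideal0 _ (Ideal (zero_at_ideal M))).
    - by case: nMv; apply: IM; exists q => //; rewrite mulrC.
    exists (u * v); first by case/spec_prime.
    move=> y /[!inE] /orP[/eqP->|ys]; first by rewrite -mulrA vx mulr0.
    by rewrite mulrAC us ?mul0r.
  apply: nMu; apply: CM; exists 0, u; split; rewrite ?add0r //.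
    exact: (ideal0 I).
  move=> y /Is/ideal_gen_seqP[c ->]; rewrite mulr_sumr big1 // => i _.
  by rewrite mulrCA us ?mulr0 ?mem_nth.
have Ia : zero_at P a by exists t.
exists b; split=> [Pb||x]; last exact: bI.
- by apply: (@spec_proper _ P); rewrite e1; apply: idealD => //; apply: zero_atW.
- by rewrite e1 addrK bI.
Qed.

(** On the component of [P] the element is [x], which is regular there; on the others it is [1]. *)
Lemma regularize (P : spec R) (e x : R) :
  ~ P e -> e * (1 - e) = 0 -> (forall y, zero_at P y -> e * y = 0) ->
  ~ zero_at P x -> GRing.lreg (e * x + (1 - e)).
Proof.
move=> nPe e_idem eP nzx; suff reg y : (e * x + (1 - e)) * y = 0 -> y = 0.
  move=> y z /eqP; rewrite -subr_eq0 -mulrBr => /eqP/reg/eqP.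
  by rewrite subr_eq0 => /eqP.
move=> dy; have ee : e * e = e by apply/esym/eqP; rewrite -subr_eq0 -{1}[e]mulr1 -mulrBr e_idem.
have exy : e * x * y = 0.
  transitivity (e * ((e * x + (1 - e)) * y) + (e * x * y - e * e * x * y) - e * (1 - e) * y).
    by ring.
  by rewrite dy e_idem ee subrr mulr0 mul0r addr0 subr0.
have ey : e * y = 0.
  have [|/nzx //|/eP //] := @normal_zero_at _ normR P x y.
  by exists e => //; rewrite mulrA.
move: dy; rewrite mulrDl exy add0r mulrBl ey subr0 mul1r //.
Qed.

Section AssociatedPrime.

Variables (P : spec R) (d c : R).
Hypotheses (regd : GRing.lreg d) (ndc : ~ divides d c).
Hypothesis PE : forall x, P x <-> divides d (x * c).

(** The fraction [c / d] maps [P] into [R]. If some image lies outside [P], its preimage [p]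
    generates [P] locally. Otherwise [c / d] maps the finitely generated ideal [P] into itself, so
    it is integral by the determinant trick, and normality contradicts [ndc]. *)
Lemma associated_prime_principal :
  exists2 p, P p & forall x, P x -> divides_at P p x.
Proof.
have [[p [t [Pp cp nPt]]]|noP] :=
    pselect (exists p t, [/\ P p, c * p = d * t & ~ P t]).
  exists p => // x /PE[x' xc]; exists t => //; exists x'; apply: regd.
  by rewrite mulrA -cp mulrAC [c * x]mulrC xc; ring.
have Pd : P d by apply/PE; apply: dividesMr; apply: divides_refl.
have [s Ps] := noeR P; pose m := size s.
have sP i : (i < m)%N -> P s`_i by move=> lt; apply/Ps => J _; apply; apply: mem_nth.
have /choice[a aE] : forall i : 'I_m, exists a : 'I_m -> R,
    c * s`_i = d * \sum_j a j * s`_j.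
  move=> i; have [t ct] : divides d (c * s`_i) by rewrite mulrC; apply/PE/sP.
  have /Ps/ideal_gen_seqP[b tb] : P t.
    by apply: contrapT => nPt; apply: noP; exists s`_i, t; split=> //; apply: sP.
  by exists (fun j => b j); rewrite ct tb.
case: ndc; apply: (normal_divides normR regd).
pose M := \matrix_(i < m, j < m) a i j.
apply: (@integral_quotient_det _ _ M) => //.
have kill i : \det (c%:M - d *: M) * s`_(nat_of_ord (i : 'I_m)) = 0.
  have := @det_annihilates _ _ (c%:M - d *: M) (\col_i s`_(nat_of_ord i)) i.
  rewrite mxE; apply; apply/matrixP=> j k; rewrite mulmxBl mul_scalar_mx -scalemxAl.
  rewrite !mxE aE -mulrBr.
  rewrite (_ : \sum_l a j l * s`_l = \sum_l M j l * (\col_i s`_(nat_of_ord i)) l k).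
    by rewrite subrr mulr0.
  by apply: eq_bigr => l _; rewrite !mxE.
(* The determinant kills [P], which contains the regular element [d]; hence it is zero. *)
have [b db] : exists b : nat -> R, d = \sum_(i < size s) b i * s`_i.
  by apply/ideal_gen_seqP/Ps.
apply: regd; rewrite mulr0 {1}db mulr_suml big1 // => i _.
by rewrite -mulrA [s`_i * _]mulrC (kill i) mulr0.
Qed.

(** The kernel of localization at [P] is a prime strictly below [P], since [d] is regular. In a
    chain [Q 0 < Q 1 < P], the local generator [p] of [P] is outside [Q 1], so every element of
    [Q 1] is locally [p] times an element of [Q 1]. As in Nakayama's lemma, a determinant outside
    [P] then kills [Q 1], which forces [Q 1] into [Q 0]. *)
Lemma associated_prime_height_one : height_one P.
Proof.
have Pd : P d by apply/PE; apply: dividesMr; apply: divides_refl.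
have nz0 : ~ zero_at P d.
  move=> [s nPs sd]; apply: nPs; suff -> : s = 0 by apply: ideal0.
  by apply: regd; rewrite mulr0 mulrC.
have [p Pp divp] := associated_prime_principal.
split.
  have proper0 : ~ Ideal (zero_at_ideal P) 1 by move=> /zero_atW/spec_proper.
  pose Q0 := Spec proper0 (@normal_zero_at _ normR P).
  exists (fun i => if i is 0%N then Q0 else P); split=> // -[|//] _.
  by split=> [x /zero_atW//|/(_ d Pd)].
move=> [Q [chain Q2]].
have [sub01 nsub10] := chain 0%N isT; have [sub12 nsub21] := chain 1%N isT.
have sub1P x : Q 1%N x -> P x by move=> /sub12/Q2.
have nQp : ~ Q 1%N p.
  move=> Qp; apply: nsub21 => x /Q2/divp[s nPs /(ideal_divides Qp)/spec_prime[|//]].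
  by move=> /sub1P.
apply: nsub10 => x Q1x; have [s Qs] := noeR (Q 1%N); pose m := size s.
have sQ i : (i < m)%N -> Q 1%N s`_i.
  by move=> lt; apply/Qs => J _; apply; apply: mem_nth.
have /choice[ta taE] : forall i : 'I_m, exists ta : R * ('I_m -> R),
    ~ P ta.1 /\ ta.1 * s`_i = p * \sum_j ta.2 j * s`_j.
  move=> i; have [t nPt [q tq]] := divp _ (sub1P _ (sQ i (ltn_ord i))).
  have /Qs/ideal_gen_seqP[b qb] : Q 1%N q.
    have : Q 1%N (p * q) by rewrite -tq; apply: ideal_mull; apply: sQ.
    by case/spec_prime.
  by exists (t, fun j : 'I_m => b j); rewrite tq qb.
pose M := \matrix_(i < m, j < m) ((ta i).1 *+ (i == j) - p * (ta i).2 j).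
have kill i : \det M * s`_(nat_of_ord (i : 'I_m)) = 0.
  have := @det_annihilates _ _ M (\col_i s`_(nat_of_ord i)) i.
  rewrite mxE; apply; apply/matrixP=> j k; rewrite !mxE.
  have [_ e] := taE j.
  transitivity ((ta j).1 * s`_j - p * \sum_l (ta j).2 l * s`_l); last by rewrite e subrr.
  rewrite mulr_sumr (bigD1 j) //= !mxE eqxx mulr1n mulrBl -mulrA [in RHS](bigD1 j) //=.
  rewrite opprD addrA; congr (_ + _); rewrite -sumrN; apply: eq_bigr => l.
  by rewrite eq_sym => /negPf ne; rewrite !mxE ne mulr0n sub0r mulNr mulrA.
have nPdet : ~ P (\det M).
  have [r ->] : exists r, \det M = \prod_i (ta i).1 + p * r.
    suff : divides p (\det M - \prod_i (ta i).1).
      by move=> [r e]; exists r; rewrite -e addrC subrK.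
    (* [N] is [M] with [p] replaced by an indeterminate; its determinants at [p] and at [0] differ
       by a multiple of [p]. *)
    pose N : 'M[{poly R}]_m :=
      \matrix_(i, j) ((ta i).1%:P *+ (i == j) - 'X * ((ta i).2 j)%:P).
    have evalN z : (\det N).[z] = \det (\matrix_(i, j) ((ta i).1 *+ (i == j) - z * (ta i).2 j)).
      rewrite -/(horner_eval z _) -det_map_mx; congr (\det _).
      apply/matrixP=> i j; rewrite !mxE rmorphB rmorphMn rmorphM /= /horner_eval.
      by rewrite hornerX !hornerC.
    have -> : \prod_i (ta i).1 = (\det N).[0].
      rewrite evalN (_ : \matrix_(i, j) _ = diag_mx (\row_i (ta i).1)).
        by rewrite det_diag; apply: eq_bigr => i _; rewrite mxE.
      by apply/matrixP=> i j; rewrite !mxE mul0r subr0.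
    have -> : \det M = (\det N).[p] by rewrite evalN.
    elim/poly_ind: (\det N) => [|q b _]; first by rewrite !horner0 subrr; apply: divides0.
    by rewrite !hornerMXaddC mulr0 add0r addrK; exists q.[p]; rewrite mulrC.
  rewrite addrC => /(idealDK (ideal_mulr r Pp)); apply: prime_prod => i.
  by have [] := taE i.
have nQdet : ~ Q 0%N (\det M) by move=> /sub01/sub1P.
have : Q 0%N (\det M * x).
  have /Qs/ideal_gen_seqP[b ->] := Q1x.
  rewrite mulr_sumr big1; first exact: ideal0.
  by move=> i _; rewrite mulrCA (kill i) mulr0.
by case/spec_prime.
Qed.

End AssociatedPrime.

End NoetherianNormal.

(** * A spanning family *)

Definition is_subring (R : comNzRingType) (S : R -> Prop) : Prop :=
  [/\ S 1, forall x y, S x -> S y -> S (x - y) & forall x y, S x -> S y -> S (x * y)].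

Definition lin_span (R : comNzRingType) (S : R -> Prop) (l : seq R) (x : R) : Prop :=
  exists c : nat -> R, (forall i, S (c i)) /\ x = \sum_(i < size l) c i * l`_i.

Section Span.

Variables (R : comNzRingType) (S : R -> Prop) (subS : is_subring S).

Lemma subring1 : S 1. Proof. by case: subS. Qed.

Lemma subring0 : S 0.
Proof. by case: subS => S1 SB _; rewrite -(subrr 1); apply: SB. Qed.

Lemma subringN x : S x -> S (- x).
Proof. by case: subS => S1 SB _ Sx; rewrite -sub0r; apply: SB => //; apply: subring0. Qed.

Lemma subringD x y : S x -> S y -> S (x + y).
Proof.
by case: subS => S1 SB _ Sx Sy; rewrite -[y]opprK; apply: SB => //; apply: subringN.
Qed.

Lemma subringM x y : S x -> S y -> S (x * y).
Proof. by case: subS => _ _; apply. Qed.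

Lemma subringX x k : S x -> S (x ^+ k).
Proof.
move=> Sx; elim: k => [|k IHk]; first by rewrite expr0; apply: subring1.
by rewrite exprS; apply: subringM.
Qed.

Variable l : seq R.

Lemma span0 : lin_span S l 0.
Proof.
exists (fun=> 0); split=> [_|]; first exact: subring0.
by rewrite big1 // => i _; rewrite mul0r.
Qed.

Lemma spanD x y : lin_span S l x -> lin_span S l y -> lin_span S l (x + y).
Proof.
move=> [c [Sc ->]] [c' [Sc' ->]]; exists (fun i => c i + c' i).
split=> [i|]; first exact: subringD.
by rewrite -big_split; apply: eq_bigr => i _; rewrite mulrDl.
Qed.

Lemma spanZ a x : S a -> lin_span S l x -> lin_span S l (a * x).
Proof.
move=> Sa [c [Sc ->]]; exists (fun i => a * c i); split=> [i|]; first exact: subringM.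
by rewrite mulr_sumr; apply: eq_bigr => i _; rewrite mulrA.
Qed.

Lemma spanN x : lin_span S l x -> lin_span S l (- x).
Proof. by rewrite -mulN1r; apply: spanZ; apply/subringN/subring1. Qed.

Lemma span_sum (I : Type) (r : seq I) (p : pred I) (F : I -> R) :
  (forall i, p i -> lin_span S l (F i)) -> lin_span S l (\sum_(i <- r | p i) F i).
Proof.
by move=> VF; elim/big_ind: _ => //; [apply: span0 | move=> ? ?; apply: spanD].
Qed.

Lemma span_mem x : x \in l -> lin_span S l x.
Proof.
move=> xl; have lt : (index x l < size l)%N by rewrite index_mem.
exists (fun i => (i == index x l)%:R); split=> [i|].
  by case: eqP => _; [apply: subring1 | apply: subring0].
rewrite (bigD1 (Ordinal lt)) //= eqxx mul1r nth_index // big1 ?addr0 // => i.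
by rewrite -val_eqE /= => /negPf->; rewrite mul0r.
Qed.

Lemma span_stable x :
  (forall y, y \in l -> lin_span S l (x * y)) -> forall y, lin_span S l y -> lin_span S l (x * y).
Proof.
move=> xl y [c [Sc ->]]; rewrite mulr_sumr; apply: span_sum => i _.
by rewrite mulrCA; apply: spanZ => //; apply/xl/mem_nth.
Qed.

Lemma span_subring : 1 \in l ->
  (forall x y, x \in l -> y \in l -> lin_span S l (x * y)) -> is_subring (lin_span S l).
Proof.
move=> l1 lM; split; first exact: span_mem.
  by move=> x y Vx Vy; apply: spanD => //; apply: spanN.
move=> x y Vx; apply: span_stable => z zl; rewrite mulrC.
by apply: span_stable Vx => t tl; apply: lM.
Qed.

End Span.

Lemma span_prod (R : comNzRingType) (S : R -> Prop) (l1 l2 : seq R) :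
  is_subring S -> is_subring (lin_span S l1) ->
  forall x, lin_span (lin_span S l1) l2 x <-> lin_span S [seq u * v | u <- l1, v <- l2] x.
Proof.
move=> subS subS' x; split.
  move=> [c [Sc ->]]; apply: span_sum => // i _; have [b [Sb ->]] := Sc i.
  rewrite mulr_suml; apply: span_sum => // j _; rewrite -mulrA; apply: spanZ => //.
  by apply: span_mem => //; apply: allpairs_f; apply: mem_nth.
move=> [c [Sc ->]]; apply: span_sum => // i _.
have /allpairsP[[u v] /= [ul vl ->]] := mem_nth 0 (ltn_ord i).
rewrite mulrA; apply: spanZ => //; last exact: span_mem.
by apply: spanZ => //; apply: span_mem.
Qed.

(** Synthetic division by ['X - (e ^+ 2)%:P], started from the top coefficient: the recursion [step]
    is iterated until the index exceeds the degree of the quotient. *)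
Lemma prod_sqr_coef_rec (R : comNzRingType) (e : R) (s : seq R) (m j : nat) :
  (size s < m)%N ->
  (\prod_(x <- s) ('X - (x ^+ 2)%:P))`_j =
  \sum_(k < m) (\prod_(x <- e :: s) ('X - (x ^+ 2)%:P))`_(j.+1 + k) * e ^+ (2 * k).
Proof.
rewrite big_cons; set q := \prod_(x <- s) _ => lt.
have step i : q`_i = (('X - (e ^+ 2)%:P) * q)`_i.+1 + e ^+ 2 * q`_i.+1.
  by rewrite mulrBl coefB coefXM coefCM subrK.
suff sumE K : q`_j = \sum_(k < K) (('X - (e ^+ 2)%:P) * q)`_(j.+1 + k) * e ^+ (2 * k)
    + e ^+ (2 * K) * q`_(j + K).
  rewrite [LHS](sumE m) [q`_(j + m)]nth_default ?mulr0 ?addr0 //.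
  by rewrite size_prod_XsubC (leq_trans lt) // leq_addl.
elim: K => [|K IHK]; first by rewrite big_ord0 add0r mul1r addn0.
rewrite IHK big_ord_recr /= -addrA; congr (_ + _).
by rewrite {1}step -addSn mulnS exprD addnS; ring.
Qed.

(* [lin_span S l1] for [l1 = beta, 1, e, ..., e ^ (2m)], where [beta] is the product
   of the other [eta]'s, is the equivariant cohomology ring of an even
   dimensional quadric: [e * beta = alpha] and [beta ^ 2] is a polynomial of
   degree [2m] in [e], so that [e ^ (2m + 1)] is a multiple of [beta] modulo
   lower powers. *)
Lemma typeD_span (R : comNzRingType) (s : seq R) (S : R -> Prop) :
  is_subring S -> s != [::] ->
  (forall i, S (\prod_(x <- s) ('X - (x ^+ 2)%:P))`_i) -> S (\prod_(x <- s) x) ->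
  exists l, [/\ size l = (2 ^ (size s).-1 * (size s)`!)%N, 1 \in l &
    forall x, x \in s -> forall y, lin_span S l y -> lin_span S l (x * y)].
Proof.
elim: s S => [//|e s IHs] S subS _ coefS prodS.
(* A single remaining root equals the product, which is already in [S]; nothing has to be
   adjoined. *)
have [s0|s_neq0] := eqVneq s [::].
  exists [:: 1]; rewrite s0; split; rewrite ?mem_head //.
  move=> x /[!inE] /eqP-> y; apply: spanZ => //.
  by move: prodS; rewrite s0 big_seq1.
pose m := size s; have m_gt0 : (0 < m)%N by rewrite lt0n size_eq0.
pose beta := \prod_(x <- s) x; pose alpha := e * beta.
have Salpha : S alpha by move: prodS; rewrite big_cons.
(* This list has [2 * m.+1] elements, twice the number of roots in [e :: s]; the product of these
   lengths down to two roots is the announced size. *)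
pose l1 := beta :: [seq e ^+ k | k <- iota 0 (2 * m).+1].
have Ve k : (k <= 2 * m)%N -> lin_span S l1 (e ^+ k).
  move=> le_k; apply: span_mem => //; rewrite inE map_f ?orbT //.
  by rewrite mem_iota add0n ltnS.
have Vbeta : lin_span S l1 beta by apply: span_mem => //; rewrite mem_head.
have V1 : lin_span S l1 1 by rewrite -(expr0 e); apply: Ve.
have VS a : S a -> lin_span S l1 a by move=> Sa; rewrite -[a]mulr1; apply: spanZ.
set p := \prod_(x <- e :: s) _ in coefS.
pose q := \prod_(x <- s) ('X - (x ^+ 2)%:P).
have qE j : q`_j = \sum_(k < m.+1) p`_(j.+1 + k) * e ^+ (2 * k).
  by apply: prod_sqr_coef_rec.
have Vq j : lin_span S l1 q`_j.
  rewrite qE; apply: span_sum => // k _; apply: spanZ => //; apply: Ve.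
  by rewrite leq_mul2l -ltnS ltn_ord orbT.
have q0E : q`_0 = (-1) ^+ m * beta ^+ 2.
  rewrite -horner_coef0 horner_prod /beta /m.
  elim: (s) => [|x s' IHs']; first by rewrite !big_nil expr1n mulr1.
  by rewrite /= !big_cons IHs' hornerXsubC [(-1) ^+ (size s').+1]exprS; ring.
have Ssign : S ((-1) ^+ m).
  by apply: subringX => //; apply: subringN => //; apply: subring1.
have beta2 : beta ^+ 2 = (-1) ^+ m * q`_0 by rewrite q0E mulrA -exprMn mulrNN mulr1 expr1n mul1r.
have Vbeta2 : lin_span S l1 (beta ^+ 2).
  by rewrite beta2; apply: spanZ.
have pm : p`_m.+1 = 1.
  have szp : size p = m.+2 by rewrite size_prod_XsubC.
  have /monicP : p \is monic by apply: monic_prod_XsubC.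
  by rewrite lead_coefE szp.
have Vetop : lin_span S l1 (e ^+ (2 * m).+1).
  have : e * q`_0 = (-1) ^+ m * (alpha * beta) by rewrite q0E /alpha; ring.
  rewrite qE big_ord_recr /= add1n pm mul1r mulrDr -exprS; set X := e * _ => E.
  have -> : e ^+ (2 * m).+1 = (-1) ^+ m * (alpha * beta) - X by rewrite -E addrAC subrr add0r.
  apply: spanD => //.
    by rewrite mulrA; apply: spanZ => //; apply: subringM.
  apply: spanN => //; rewrite /X mulr_sumr; apply: span_sum => // k _.
  rewrite mulrCA; apply: spanZ => //; rewrite -exprS; apply: Ve.
  by rewrite ltn_mul2l ltn_ord.
have stable_e x : x \in l1 -> lin_span S l1 (e * x).
  rewrite inE => /orP[/eqP->|]; first exact: VS.
  move=> /mapP[k]; rewrite mem_iota add0n ltnS => /andP[_ le_k] ->.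
  rewrite -exprS; have [->|lt_k] := eqVneq k (2 * m)%N; first by [].
  by apply: Ve; rewrite ltn_neqAle lt_k.
have stable_ek k y : lin_span S l1 y -> lin_span S l1 (e ^+ k * y).
  elim: k => [|k IHk] Vy; first by rewrite mul1r.
  by rewrite exprS -mulrA; apply: span_stable => //; apply: IHk.
have stable_beta y : lin_span S l1 y -> lin_span S l1 (beta * y).
  apply: span_stable => // x; rewrite inE => /orP[/eqP->|]; first by rewrite -expr2.
  move=> /mapP[[|k]]; rewrite mem_iota add0n ltnS => /andP[_ le_k] ->.
    by rewrite mulr1.
  rewrite exprS mulrA [beta * e]mulrC; apply: spanZ => //; apply: Ve.
  exact: ltnW.
have subV : is_subring (lin_span S l1).
  apply: span_subring => //.
    by rewrite inE; apply/orP; right; apply/mapP; exists 0%N.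
  move=> x y; rewrite inE => /orP[/eqP->|/mapP[k _ ->]] yl.
    by apply: stable_beta; apply: span_mem.
  by apply: stable_ek; apply: span_mem.
(* The other roots are adjoined to the subring spanned by [l1], which contains the coefficients of
   [q] and the product [beta]. *)
have [l2 [szl2 l21 stable2]] := IHs _ subV s_neq0 Vq Vbeta.
have prodP := span_prod l2 subS subV.
exists [seq u * v | u <- l1, v <- l2]; split.
- rewrite size_allpairs szl2 /= size_map size_iota factS -/m.
  by case: (m) m_gt0 => // k _; rewrite /= expnS; ring.
- apply/allpairsP; exists (1, 1); split=> //=; rewrite ?mulr1 //.
  by rewrite inE; apply/orP; right; apply/mapP; exists 0%N.
- move=> x /[!inE] xs y /prodP Vy; apply/prodP; case/orP: xs => [/eqP->|xs].
    by apply: spanZ => //; rewrite -[e]expr1; apply: Ve; rewrite muln_gt0.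
  exact: stable2.
Qed.

(** * The Weyl group *)

Definition even_signs (n : nat) (w : 'S_n * {ffun 'I_n -> bool}) : bool :=
  ~~ \big[addb/false]_i w.2 i.

(* The Weyl group of type D_n. *)
Definition weylD (n : nat) : Type := {w | @even_signs n w}.

HB.instance Definition _ n := Finite.on (weylD n).

Section WeylD.

Variable n : nat.
Implicit Types v w : weylD n.

Definition wperm w : 'S_n := (val w).1.
Definition wsign w : {ffun 'I_n -> bool} := (val w).2.

Lemma weyl_eq v w :
  (forall i, wperm v i = wperm w i) -> (forall i, wsign v i = wsign w i) -> v = w.
Proof.
move=> /permP eqp /ffunP eqs; apply: val_inj; move: eqp eqs; rewrite /wperm /wsign.
by case: (val v) (val w) => [? ?] [? ?] /= -> ->.
Qed.

Lemma weyl1_subproof :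
  even_signs ((1%g : 'S_n), [ffun _ : 'I_n => false]).
Proof. by rewrite /even_signs big1 // => i _; rewrite ffunE. Qed.

Definition weyl1 : weylD n := exist (@even_signs _) _ weyl1_subproof.

Lemma weyl_mul_subproof v w :
  even_signs ((wperm w * wperm v)%g, [ffun i => wsign w i (+) wsign v (wperm w i)]).
Proof.
rewrite /even_signs /=; under eq_bigr => i _ do rewrite ffunE /=.
rewrite big_split -(reindex_inj (F := wsign v) (P := xpredT)) /=; last exact: perm_inj.
by rewrite (negPf (valP v)) (negPf (valP w)).
Qed.

(** The composite of signed permutations, [w] acting first; products in ['S_n] compose from left to
    right, whence the order in the first component. *)
Definition weyl_mul v w : weylD n := exist (@even_signs _) _ (weyl_mul_subproof v w).

Lemma wperm1 i : wperm weyl1 i = i. Proof. by rewrite /wperm perm1. Qed.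
Lemma wsign1 i : wsign weyl1 i = false. Proof. by rewrite /wsign ffunE. Qed.

Lemma wpermM v w i : wperm (weyl_mul v w) i = wperm v (wperm w i).
Proof. by rewrite /wperm /= permM. Qed.

Lemma wsignM v w i : wsign (weyl_mul v w) i = wsign w i (+) wsign v (wperm w i).
Proof. by rewrite {1}/wsign /= ffunE. Qed.

Lemma weyl_mul1 v : weyl_mul v weyl1 = v.
Proof.
by apply: weyl_eq => i; rewrite ?wpermM ?wsignM wperm1 ?wsign1.
Qed.

Lemma weyl_mulI v : injective (weyl_mul v).
Proof.
move=> w w' e; have ep i : wperm w i = wperm w' i.
  by apply: (@perm_inj _ (wperm v)); rewrite -!wpermM e.
apply: weyl_eq => // i; apply: (@addIb (wsign v (wperm w i))).
by rewrite -wsignM e wsignM ep.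
Qed.

(** All signs but the one at index [0] are free, and that one restores parity. The bound lets the
    spanning list of [typeD_span] be indexed by the group. *)
Lemma card_weylD : (0 < n)%N -> (2 ^ n.-1 * n`! <= #|{: weylD n}|)%N.
Proof.
have gt m : (0 < m)%N -> m = m.-1.+1 by case: m.
move=> n_gt0; move: (gt _ n_gt0) => en.
suff inj m (e : n = m.+1) : (2 ^ m * n`! <= #|{: weylD n}|)%N by apply: inj.
subst n; pose D := ('S_m.+1 * {ffun 'I_m -> bool})%type.
pose ext (d : {ffun 'I_m -> bool}) : {ffun 'I_m.+1 -> bool} :=
  [ffun i => if unlift ord0 i is Some j then d j else \big[addb/false]_j d j].
have even (x : D) : even_signs (x.1, ext x.2).
  rewrite /even_signs big_ord_recl /= ffunE unlift_none
    [X in _ (+) X](eq_bigr (fun j => x.2 j)) ?addbb //.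
  by move=> j _; rewrite ffunE liftK.
pose F (x : D) : weylD m.+1 := exist (@even_signs _) _ (even x).
have injF : injective F.
  move=> [s d] [s' d'] /(congr1 val) /= [-> e]; congr (_, _); apply/ffunP => j.
  by move/ffunP: e => /(_ (lift ord0 j)); rewrite !ffunE liftK.
have -> : (2 ^ m * m.+1`!)%N = #|{: D}|.
  by rewrite card_prod card_Sn card_ffun card_bool card_ord mulnC.
by rewrite -(card_codom injF) max_card.
Qed.

End WeylD.

(** * Normality of an extension with an action of the Weyl group *)

Lemma divides_prod_exp (R : comNzRingType) (I : finType) (p : pred I) (F : I -> R) x :
  (forall i, p i -> divides (F i) x) -> exists k, divides (\prod_(i | p i) F i) (x ^+ k).
Proof.
move=> Fx; elim/big_rec: _ => [|i y pi [k yk]].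
  by exists 0%N; rewrite expr0; apply: divides_refl.
by exists k.+1; rewrite exprS; apply: divides_mul => //; apply: Fx.
Qed.

Section TypeDExtension.

(** To be applied with [B] the splitting ring and [delta] the discriminant [tilde_disc]. *)
Variables (A B : comNzRingType) (phi : {rmorphism A -> B}) (n : nat) (eta : 'I_n -> B).
Variables (act : weylD n -> {rmorphism B -> B}) (alpha delta : A).

Hypothesis n_gt0 : (0 < n)%N.
Hypothesis act_phi : forall w a, act w (phi a) = phi a.
Hypothesis act_eta : forall w i, act w (eta i) = (-1) ^+ wsign w i * eta (wperm w i).
Hypothesis generated : forall S : B -> Prop, is_subring S ->
  (forall a, S (phi a)) -> (forall i, S (eta i)) -> forall x, S x.
Hypothesis phi_inj : injective phi.
Hypothesis half : exists h : A, 2 * h = 1.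
Hypothesis eta_prod : \prod_i eta i = phi alpha.
Hypothesis eta_sym : forall k, exists a, (\prod_i ('X - (eta i ^+ 2)%:P))`_k = phi a.
Hypothesis delta_reg : GRing.lreg delta.
Hypothesis sqr_diff_divides : forall i j, i != j ->
  divides (eta i ^+ 2 - eta j ^+ 2) (phi delta).

Definition image_phi (x : B) : Prop := exists a, x = phi a.

Lemma image_phi_subring : is_subring image_phi.
Proof.
split=> [|_ _ [a ->] [b ->]|_ _ [a ->] [b ->]].
- by exists 1; rewrite rmorph1.
- by exists (a - b); rewrite rmorphB.
- by exists (a * b); rewrite rmorphM.
Qed.

Lemma act1 x : act (weyl1 n) x = x.
Proof.
apply: (generated (S := fun x => act (weyl1 n) x = x)) => // [|i].
  by split=> [|y z ey ez|y z ey ez]; rewrite ?rmorph1 // (rmorphB, rmorphM) ey ez.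
by rewrite act_eta wperm1 wsign1 mul1r.
Qed.

Lemma actM v w x : act v (act w x) = act (weyl_mul v w) x.
Proof.
apply: (generated (S := fun x => act v (act w x) = act (weyl_mul v w) x)) => [|a|i].
- split=> [|y z ey ez|y z ey ez]; first by rewrite !rmorph1.
    by rewrite !rmorphB ey ez.
  by rewrite !rmorphM /= ey ez.
- by rewrite !act_phi.
- rewrite !act_eta rmorphM rmorphXn rmorphN1 /= act_eta wpermM wsignM.
  by rewrite mulrA signr_addb.
Qed.

Definition trace x := \sum_w act w x.

Lemma act_trace v x : act v (trace x) = trace x.
Proof.
rewrite /trace rmorph_sum [RHS](reindex_inj (@weyl_mulI _ v)) /=.
by apply: eq_bigr => w _; rewrite actM.
Qed.

Local Notation N := #|{: weylD n}|.

Lemma spanning_family :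
  exists (b : 'I_N -> B) (i1 : 'I_N), b i1 = 1 /\
    forall x, exists c : 'I_N -> A, x = \sum_i phi (c i) * b i.
Proof.
have bigE (F : B -> B) : \prod_(x <- codom eta) F x = \prod_i F (eta i).
  by rewrite /codom big_map big_enum.
have bigE' (F : B -> {poly B}) : \prod_(x <- codom eta) F x = \prod_i F (eta i).
  by rewrite /codom big_map big_enum.
have [||||l [szl l1 stable]] := @typeD_span B (codom eta) image_phi.
- exact: image_phi_subring.
- by rewrite -size_eq0 size_codom card_ord -lt0n.
- by move=> k; rewrite bigE'; have [a ->] := eta_sym k; exists a.
- by rewrite bigE eta_prod; exists alpha.
have leN : (size l <= N)%N.
  by rewrite szl size_codom card_ord; apply: card_weylD.
have lt1 : (index (1 : B)%R l < N)%N by rewrite (leq_trans _ leN) // index_mem.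
(* The default value [0] of [nth] pads the list up to length [N]. *)
exists (fun i => l`_i), (Ordinal lt1); split; first by rewrite nth_index.
have V1 : lin_span image_phi l 1 by apply: span_mem => //; apply: image_phi_subring.
have subI := image_phi_subring.
have VM x y : lin_span image_phi l y -> lin_span image_phi l (x * y).
  move: y; apply: (generated (S := fun x => forall y, lin_span image_phi l y ->
    lin_span image_phi l (x * y))) => [|a y Vy|i y Vy].
  - split=> [y|x1 x2 V1x V2x y Vy|x1 x2 V1x V2x y Vy]; first by rewrite mul1r.
      by rewrite mulrBl; apply: spanD => //; [apply: V1x | apply: spanN => //; apply: V2x].
    by rewrite -mulrA; apply/V1x/V2x.
  - by apply: spanZ => //; exists a.
  - by apply: stable => //; apply: codom_f.
move=> x; have [c [Sc]] := VM x _ V1; rewrite mulr1 => ->.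
have [a aE] := choice Sc; exists (fun i => a i).
rewrite (big_ord_widen_cond N xpredT (fun i => c i * l`_i)) //=.
rewrite [RHS](bigID (fun i : 'I_N => (i < size l)%N)) /= [X in _ = _ + X]big1.
  by rewrite addr0; apply: eq_bigr => i _; rewrite aE.
by move=> i; rewrite -leqNgt => ge; rewrite nth_default ?mulr0.
Qed.

(* The functions [weylD n -> B] in the image of [B (x)_A B], an element [x (x) y]
   being viewed as the function [w |-> x * w(y)]. *)
Definition tensor (g : weylD n -> B) : Prop :=
  exists s : seq (B * B), forall w, g w = \sum_(p <- s) p.1 * act w p.2.

Lemma tensor_const x : tensor (fun=> x).
Proof. by exists [:: (x, 1)] => w; rewrite big_seq1 rmorph1 mulr1. Qed.

Lemma tensor_act y : tensor (fun w => act w y).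
Proof. by exists [:: (1, y)] => w; rewrite big_seq1 mul1r. Qed.

Lemma tensorD g h : tensor g -> tensor h -> tensor (fun w => g w + h w).
Proof. by move=> [s gE] [t hE]; exists (s ++ t) => w; rewrite big_cat gE hE. Qed.

Lemma tensorM g h : tensor g -> tensor h -> tensor (fun w => g w * h w).
Proof.
move=> [s gE] [t hE]; exists [seq (p.1 * q.1, p.2 * q.2) | p <- s, q <- t] => w.
rewrite gE hE big_allpairs_dep /= mulr_suml; apply: eq_bigr => p _.
by rewrite mulr_sumr; apply: eq_bigr => q _; rewrite rmorphM mulrACA.
Qed.

Lemma tensorB g h : tensor g -> tensor h -> tensor (fun w => g w - h w).
Proof.
move=> tg th; have := tensorD tg (tensorM (tensor_const (-1)) th).
by move=> [s E]; exists s => w; rewrite -E mulN1r.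
Qed.

Lemma tensor_prod (I : finType) (p : pred I) (g : I -> weylD n -> B) :
  (forall i, tensor (g i)) -> tensor (fun w => \prod_(i | p i) g i w).
Proof.
move=> tg; suff : tensor (fun w => \prod_(i <- enum I | p i) g i w).
  by move=> [s E]; exists s => w; rewrite -E big_enum_cond.
elim: (enum I) => [|i r IHr].
  by have [s E] := tensor_const 1; exists s => w; rewrite big_nil -E.
have := tensorM (tg i) IHr; case: (boolP (p i)) => pi [s E].
  by exists s => w; rewrite big_cons pi E.
by have [s' E'] := IHr; exists s' => w; rewrite big_cons (negPf pi) E'.
Qed.

(** * Interpolation on the Weyl group, the basis and the invariants *)

Definition sqr_diff (i j : 'I_n) : B := eta i ^+ 2 - eta j ^+ 2.

(** The product of the positive roots [eta i - eta j] and [eta i + eta j] of type D. *)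
Definition jacobian : B := \prod_(p : 'I_n * 'I_n | (p.1 < p.2)%N) sqr_diff p.1 p.2.

Lemma sqr_diff_jacobian i j : i != j -> divides (sqr_diff i j) jacobian.
Proof.
wlog lt : i j / (i < j)%N => [wlt|] ne.
  have /orP[lt|lt] : (i < j)%N || (j < i)%N by rewrite -neq_ltn.
    exact: wlt.
  have [e ->] := wlt _ _ lt (negbT (ltn_eqF lt)).
  by exists (- e); rewrite /sqr_diff; ring.
rewrite /jacobian (bigD1 (i, j)) //=; apply: dividesMr; exact: divides_refl.
Qed.

Lemma jacobian_delta : exists k, divides jacobian (phi delta ^+ k).
Proof.
apply: divides_prod_exp => -[i j] /= lt; apply: sqr_diff_divides.
by rewrite neq_ltn lt.
Qed.

Lemma act_sqr w i : act w (eta i ^+ 2) = eta (wperm w i) ^+ 2.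
Proof. by rewrite rmorphXn /= act_eta exprMn sqrr_sign mul1r. Qed.

(** If [w] moves the index [k], its effect on [eta k] separates it from the identity. If [w] only
    changes signs, it changes at least two, at [k] and [l]; combining both contributions gives
    [2 * (eta k ^+ 2 - eta l ^+ 2)] at the identity, whereas a single one would give a multiple of
    [eta k], which need not divide [jacobian]. *)
Lemma weyl_separate w : w != weyl1 n ->
  exists h, [/\ tensor h, h w = 0 & divides (h (weyl1 n)) jacobian].
Proof.
move=> w_neq1; have [[k ne]|allk] := pselect (exists k, wperm w k != k).
  exists (fun v => act w (eta k) - act v (eta k)); split; last first.
  - apply: divides_trans (sqr_diff_jacobian ne).
    rewrite act1 act_eta /sqr_diff; exists ((-1) ^+ wsign w k * eta (wperm w k) + eta k).
    by rewrite -subr_sqr exprMn sqrr_sign mul1r.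
  - by rewrite subrr.
  - by apply: tensorB; [apply: tensor_const | apply: tensor_act].
have wp k : wperm w k = k by apply/eqP; apply: contrapT => /negP ne; apply: allk; exists k.
have [k sk] : exists k, wsign w k.
  apply: contrapT => nosign; case/eqP: w_neq1; apply: weyl_eq => i; first by rewrite wp wperm1.
  by rewrite wsign1; apply/negP => si; apply: nosign; exists i.
have [l lk sl] : exists2 l, l != k & wsign w l.
  apply: contrapT => nol; have := valP w; rewrite /even_signs /= (bigD1 k) //= sk.
  by rewrite big1 // => l lk; apply/negP => sl; apply: nol; exists l.
exists (fun v => eta k * (act v (eta k) - act w (eta k)) -
  eta l * (act v (eta l) - act w (eta l))).
split; last first.
- rewrite !act1 !act_eta !wp sk sl !expr1.
  have [h hE] := half; apply: divides_trans (sqr_diff_jacobian _); last first.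
    by rewrite eq_sym; apply: lk.
  exists (phi h); rewrite /sqr_diff.
  have E : 2 * phi h = 1 :> B by rewrite -(rmorph_nat phi) -rmorphM hE rmorph1.
  transitivity ((eta k ^+ 2 - eta l ^+ 2) * (2 * phi h)); first by rewrite E mulr1.
  by ring.
- by rewrite !subrr !mulr0 subrr.
- have tensor_shift i : tensor (fun v => eta i * (act v (eta i) - act w (eta i))).
    apply: tensorM; first exact: tensor_const.
    by apply: tensorB; [apply: tensor_act | apply: tensor_const].
  exact: tensorB.
Qed.

Lemma interpolation : exists (g : weylD n -> B) (m : nat),
  [/\ tensor g, forall w, w != weyl1 n -> g w = 0 & divides (g (weyl1 n)) (jacobian ^+ m)].
Proof.
have /choice[h hP] : forall w, exists h, w != weyl1 n ->
    [/\ tensor h, h w = 0 & divides (h (weyl1 n)) jacobian].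
  move=> w; have [->|/weyl_separate[h hP]] := eqVneq w (weyl1 n); last by exists h.
  by exists (fun=> 0); rewrite ?eqxx.
pose g v := \prod_(w | w != weyl1 n) h w v.
have [k kP] : exists k, divides (g (weyl1 n)) (jacobian ^+ k).
  by apply: divides_prod_exp => w /hP[].
exists g, k; split=> // [|w ne].
  (* Nothing is known of [h] at the identity, while [tensor_prod] wants every factor to be a
     tensor. *)
  pose h' w := if w != weyl1 n then h w else fun=> 0.
  have [|s sP] := @tensor_prod _ (predC1 (weyl1 n)) h'.
    by move=> w; rewrite /h'; case: ifP => [/hP[]//|_]; apply: tensor_const.
  by exists s => w; rewrite -sP; apply: eq_bigr => v; rewrite /h' /= => ->.
by rewrite /g (bigD1 w) //=; have [_ -> _] := hP w ne; rewrite mul0r.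
Qed.

(** The hypothesis on [c] is a linear system with matrix [M]. Expanding the interpolating tensor on
    [b] in its second factor, and conjugating, yields [X] such that [X *m M^T] is diagonal with
    entries dividing powers of [delta]. So [\det M], which annihilates each [c i], divides a power
    of [delta]. *)
Lemma free_family (b : 'I_N -> B) :
  (forall x, exists c : 'I_N -> A, x = \sum_i phi (c i) * b i) ->
  exists k, forall c : 'I_N -> B,
    (forall w, \sum_i c i * act w (b i) = 0) -> forall i, phi delta ^+ k * c i = 0.
Proof.
move=> spanb; have [g [m [[s gE] g0 g1]]] := interpolation.
have [k Jk] := jacobian_delta.
have gdelta : divides (g (weyl1 n)) (phi delta ^+ (k * m)).
  by rewrite exprM; apply: divides_trans g1 _; apply: divides_exp.
have [x gx] : exists x : 'I_N -> B, forall w, g w = \sum_i x i * act w (b i).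
  have : exists x : 'I_N -> B, forall w,
      \sum_(p <- s) p.1 * act w p.2 = \sum_i x i * act w (b i).
    elim: (s) => [|p r [x xE]].
      by exists (fun=> 0) => w; rewrite big_nil big1 // => i _; rewrite mul0r.
    have [c cE] := spanb p.2; exists (fun i => p.1 * phi (c i) + x i) => w.
    rewrite big_cons xE {1}cE rmorph_sum mulr_sumr -big_split; apply: eq_bigr => i _.
    by rewrite rmorphM /= act_phi mulrDl mulrA.
  by move=> [x xE]; exists x => w; rewrite gE.
pose W (i : 'I_N) : weylD n := enum_val i.
pose M := \matrix_(u < N, j < N) act (W u) (b j).
pose X := \matrix_(v < N, j < N) act (W v) (x j).
(* The entry at [(v, u)] is the image under [W v] of [g] at the quotient of [W u] by [W v]. *)
have XM : X *m M^T = diag_mx (\row_v act (W v) (g (weyl1 n))).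
  apply/matrixP => v u; rewrite !mxE.
  have [w wE] : exists w, W u = weyl_mul (W v) w.
    have [f _ fK] := injF_bij (@weyl_mulI n (W v)).
    by exists (f (W u)); rewrite fK.
  transitivity (act (W v) (g w)).
    rewrite gx rmorph_sum; apply: eq_bigr => j _.
    by rewrite !mxE rmorphM /= actM wE.
  have [uv|ne] := eqVneq v u.
    rewrite mulr1n; congr (act _ (g _)); apply: (@weyl_mulI _ (W v)).
    by rewrite weyl_mul1 -wE uv.
  rewrite mulr0n g0 ?rmorph0 //; apply: contra ne => /eqP w1.
  by rewrite -(inj_eq enum_val_inj); apply/eqP; rewrite -/(W _) -/(W u) wE w1 weyl_mul1.
have [K detK] : exists K, divides (\det M) (phi delta ^+ K).
  have : divides (\det M) (\prod_v act (W v) (g (weyl1 n))).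
    exists (\det X); rewrite -[\det M]det_tr mulrC -det_mulmx XM det_diag.
    by apply: eq_bigr => i _; rewrite mxE.
  have [K KP] : exists K, divides (\prod_v act (W v) (g (weyl1 n))) ((phi delta ^+ (k * m)) ^+ K).
    apply: (@divides_prod_exp _ _ xpredT) => v _; have [e eE] := gdelta.
    by exists (act (W v) e); rewrite -rmorphM -eE rmorphXn /= act_phi.
  by move=> /divides_trans/(_ KP); rewrite -exprM; exists (k * m * K)%N.
exists K => c cM i; have [e ->] := detK.
have := @det_annihilates _ _ M (\col_i c i) i; rewrite mxE mulrAC => ->; first by rewrite mul0r.
apply/matrixP => u j; rewrite !mxE -[RHS](cM (W u)); apply: eq_bigr => l _.
by rewrite !mxE mulrC.
Qed.

Lemma basis_exists : exists (b : 'I_N -> B) (i1 : 'I_N), [/\ b i1 = 1,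
  forall x, exists c : 'I_N -> A, x = \sum_i phi (c i) * b i &
  forall c : 'I_N -> A, \sum_i phi (c i) * b i = 0 -> forall i, c i = 0].
Proof.
have [b [i1 [b1 spanb]]] := spanning_family; exists b, i1; split=> // c c0 i.
have [k kP] := free_family spanb.
apply: (@lregX _ _ k delta_reg); rewrite mulr0; apply: phi_inj.
rewrite rmorphM rmorphXn rmorph0; apply: (kP (fun i => phi (c i))) => w.
transitivity (act w (\sum_i phi (c i) * b i)); last by rewrite c0 rmorph0.
rewrite rmorph_sum; apply: eq_bigr => j _.
by rewrite rmorphM /= act_phi.
Qed.

Lemma phi_lreg (d : A) : GRing.lreg d -> GRing.lreg (phi d).
Proof.
move=> regd; have [b [i1 [_ spanb freeb]]] := basis_exists.
suff reg x : phi d * x = 0 -> x = 0.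
  by move=> x y /eqP; rewrite -subr_eq0 -mulrBr => /eqP/reg/eqP; rewrite subr_eq0 => /eqP.
have [c ->] := spanb x; rewrite mulr_sumr => dc0.
have c0 i : d * c i = 0.
  apply: (freeb (fun i => d * c i)); rewrite -[RHS]dc0; apply: eq_bigr => j _.
  by rewrite rmorphM mulrA.
by rewrite big1 // => i _; rewrite (regd (c i) 0) ?rmorph0 ?mul0r // c0 mulr0.
Qed.

Lemma jacobian_lreg : GRing.lreg jacobian.
Proof.
have [k [e kE]] := jacobian_delta.
have reg : GRing.lreg (phi delta ^+ k) by apply/lregX/phi_lreg.
by move=> x y xy; apply: reg; rewrite kE mulrAC xy mulrAC.
Qed.

(** Applying [w] to the expansion of [x] on [b] gives the same sum as [x * act w (b i1)], since
    [b i1 = 1]. By [free_family] the two lists of coefficients agree up to a power of [delta], so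
    [x] is the coefficient at [i1]. *)
Lemma act_invariant x : (forall w, act w x = x) -> exists a, x = phi a.
Proof.
move=> xW; have [b [i1 [b1 spanb _]]] := basis_exists.
have [k kP] := free_family spanb; have [c cE] := spanb x.
have reg : GRing.lreg (phi delta ^+ k) by apply/lregX/phi_lreg.
exists (c i1); apply: reg; apply/eqP; rewrite -subr_eq0 -mulrBr; apply/eqP.
pose e i := x *+ (i == i1) - phi (c i).
have := kP e _ i1; rewrite /e eqxx; apply=> w.
under eq_bigr => i _ do rewrite mulrBl.
rewrite sumrB (bigD1 i1) //= eqxx b1 rmorph1 mulr1 mulr1n big1 ?addr0; last first.
  by move=> i /negPf ->; rewrite mul0r.
apply/eqP; rewrite subr_eq0; apply/eqP; rewrite -{1}(xW w) {1}cE rmorph_sum.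
by apply: eq_bigr => i _; rewrite rmorphM /= act_phi.
Qed.

Lemma trace_image x : exists a, trace x = phi a.
Proof. by apply: act_invariant => w; apply: act_trace. Qed.

(** The polynomial whose roots are the conjugates of [x] has invariant coefficients. *)
Lemma integral_over_base x : exists2 q : {poly A}, q \is monic & (map_poly phi q).[x] = 0.
Proof.
pose p := \prod_w ('X - (act w x)%:P).
have /choice[a aE] : forall k, exists a, p`_k = phi a.
  move=> k; apply: act_invariant => v; rewrite -coef_map /=; suff -> : map_poly (act v) p = p by [].
  rewrite /p rmorph_prod [RHS](reindex_inj (@weyl_mulI _ v)) /=.
  by apply: eq_bigr => w _; rewrite map_polyXsubC /= actM.
have szp : size p = N.+1.
  rewrite /p -big_enum size_prod_XsubC; congr _.+1.
  by rewrite -cardE.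
have mon_p : p \is monic by apply: monic_prod_XsubC.
have aN : a N = 1.
  by apply: phi_inj; rewrite -aE rmorph1 -(monicP mon_p) lead_coefE szp.
have szq : size (\poly_(k < N.+1) a k) = N.+1.
  by rewrite size_poly_eq // aN oner_eq0.
exists (\poly_(k < N.+1) a k); first by rewrite monicE lead_coefE szq coef_poly ltnSn aN.
have -> : map_poly phi (\poly_(k < N.+1) a k) = p.
  apply/polyP => k; rewrite coef_map coef_poly /=; case: ifP => [_|/negbT]; first by rewrite -aE.
  by rewrite -leqNgt => le; rewrite rmorph0 nth_default // szp.
rewrite /p horner_prod (bigD1 (weyl1 n)) //= hornerXsubC act1 subrr mul0r //.
Qed.

Lemma sum_tensor g q : tensor g -> exists s : seq (B * B),
  \sum_w g w * act w q = \sum_(p <- s) p.1 * trace (p.2 * q).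
Proof.
move=> [s gE]; exists s; under eq_bigr => w _ do rewrite gE mulr_suml.
rewrite exchange_big; apply: eq_bigr => p _; rewrite /trace mulr_sumr.
by apply: eq_bigr => w _; rewrite rmorphM mulrA.
Qed.

(** * Traces over a normal base: reducedness and the conductor *)

Section NormalBase.

Hypotheses (noeA : noetherian A) (normA : normal A).

(** Traces of multiples of [x] lie in every prime, so they come from nilpotents of [A] and vanish;
    by interpolation a power of [jacobian] then kills [x]. *)
Lemma extension_reduced (x : B) k : x ^+ k = 0 -> x = 0.
Proof.
move=> xk; have [g [m [tg g0 [e g1]]]] := interpolation.
have [s sE] := sum_tensor x tg.
have : g (weyl1 n) * x = 0.
  have -> : g (weyl1 n) * x = \sum_w g w * act w x.
    rewrite (bigD1 (weyl1 n)) //= act1 big1 ?addr0 // => w /g0 ->.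
    by rewrite mul0r.
  rewrite sE big1 // => p _; have [a aE] := trace_image (p.2 * x).
  suff a0 : a = 0 by rewrite aE a0 rmorph0 mulr0.
  have [|l al] := @nilpotent_of_primes _ (phi a).
    move=> Q; rewrite -aE; apply: ideal_sum => w _; apply: (@prime_exp _ _ _ k).
    by rewrite -rmorphXn exprMn xk mulr0 rmorph0; apply: ideal0.
  apply: (@normal_reduced _ normA _ l); apply: phi_inj.
  by rewrite rmorphXn al rmorph0.
move=> gx; apply: (@lregX _ _ m jacobian_lreg).
by rewrite g1 mulr0 mulrAC gx mul0r.
Qed.

(** The conjugates [z w] of [b / d] are integral over [B], hence over [A], and [a / d] is a
    combination of them with coefficients in [B]. *)
Lemma integral_trace (d : A) (b y : B) (a : A) :
  GRing.lreg d -> integral_quotient (phi d) b -> trace (y * b) = phi a -> divides d a.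
Proof.
move=> regd intb aE; apply: (normal_divides normA regd).
pose F := total_frac B; pose h : {rmorphism B -> F} := @to_frac B.
pose hphi : {rmorphism A -> F} := h \o phi.
have regF : GRing.lreg (h (phi d)) by apply/to_frac_lreg/phi_lreg.
have hphi_inj : injective hphi by move=> ? ? /to_frac_inj/phi_inj.
have intB x : integralOver hphi (h x).
  have [q mon_q q0] := integral_over_base x; exists q => //.
  by apply/rootP; rewrite map_poly_comp horner_map q0 rmorph0.
have /choice[z zE] : forall w, exists z, h (phi d) * z = h (act w b).
  by move=> w; apply/frac_exists/phi_lreg.
have intz w : integralOver hphi (z w).
  have : integralOver h (z w).
    apply/(integral_quotientP (@to_frac_inj B) regF (zE w)).
    by rewrite -(act_phi w); apply: integral_quotient_rmorph.
  move=> [p mon_p rp]; apply: (integral_root_monic _ rp); first exact: monic_map.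
  move=> c /(nthP 0)[i _ <-]; rewrite coef_map; exact: intB.
pose t := \sum_w h (act w y) * z w.
apply/(@integral_quotientP _ _ hphi d a t) => //.
  rewrite /= -aE mulr_sumr rmorph_sum; apply: eq_bigr => w _.
  by rewrite mulrCA zE !rmorphM.
rewrite /t; elim/big_ind: _ => [|u v|w _].
- by rewrite -(rmorph0 hphi); apply: integral_id.
- exact: integral_add.
- by apply: integral_mul.
Qed.

(** Interpolation writes [g (weyl1 n) * b] as a combination of traces of multiples of [b], all
    divisible by [d]; the exponent depends on [g] alone. *)
Lemma conductor_exponent : exists m, forall (d : A) (b : B), GRing.lreg d ->
  integral_quotient (phi d) b -> divides (phi d) (jacobian ^+ m * b).
Proof.
have [g [m [tg g0 [e g1]]]] := interpolation; exists m => d b regd intb.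
have [s sE] := sum_tensor b tg.
rewrite g1 mulrAC; apply: dividesMr.
have -> : g (weyl1 n) * b = \sum_w g w * act w b.
  by rewrite (bigD1 (weyl1 n)) //= act1 big1 ?addr0 // => w /g0 ->; rewrite mul0r.
rewrite sE; apply: divides_sum => p _; apply: dividesMl.
have [a aE] := trace_image (p.2 * b); rewrite aE.
have [c ->] := integral_trace regd intb aE; rewrite rmorphM.
by apply: dividesMr; apply: divides_refl.
Qed.

End NormalBase.

(** * Conjugate primes, inertia and reflections *)

Lemma act_iter w k x : iter k (act w) x = act (iter k (weyl_mul w) (weyl1 n)) x.
Proof. by elim: k => [|k IHk] /=; rewrite ?act1 // IHk actM. Qed.

(** Since [w] has finite order, [act w x] is reached from [x] by applying the inverse of [w]
    repeatedly. *)
Lemma act_stable_prime (Q : spec B) w :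
  (forall x, Q (act w x) -> Q x) -> forall x, Q x -> Q (act w x).
Proof.
move=> Qw x Qx; pose k := (order (weyl_mul w) (weyl1 n)).-1.
have iter_id : iter k.+1 (act w) x = x.
  rewrite act_iter /k prednK ?order_gt0 // iter_order ?act1 //.
  exact: weyl_mulI.
have : Q (iter k (act w) (act w x)) by rewrite -iterSr iter_id.
by elim: (k) => [//|m IHm] /= /Qw.
Qed.

(* Conjugate primes are incomparable, so some element outside [Q] multiplies [Q]
   into the intersection of its conjugates. *)
Lemma conjugate_avoidance (Q : spec B) :
  exists2 x, ~ Q x & forall q, Q q -> forall w, Q (act w (x * q)).
Proof.
have /choice[x xP] : forall w, exists x, ~ Q x /\ forall q, Q q -> Q (act w (x * q)).
  (* Without such an [x], the preimage of [Q] under [act w] lies in [Q], so [act w] maps [Q] into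
     itself and the factor [1] is enough. *)
  move=> w; have [[x [Qwx nQx]]|nox] := pselect (exists x, Q (act w x) /\ ~ Q x).
    by exists x; split=> // q _; rewrite rmorphM; apply: ideal_mulr.
  exists 1; split=> [|q Qq]; first exact: spec_proper.
  rewrite mul1r; apply: act_stable_prime => // y Qwy.
  by apply: contrapT => nQy; apply: nox; exists y.
exists (\prod_w x w); first by apply: prime_prod => w; case: (xP w).
move=> q Qq w; rewrite (bigD1 w) //= -mulrA; have [_] := xP w; apply.
exact: ideal_mull.
Qed.

Section Reflection.

Variables (Q : spec B) (i j : 'I_n) (c : bool).
Hypothesis ij : i != j.
Hypothesis nQeta : forall k, ~ Q (eta k).
Hypothesis Q_other : forall k l, Q (sqr_diff k l) -> k != l ->
  (k == i) && (l == j) || (k == j) && (l == i).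

Let theta := eta i - (-1) ^+ c * eta j.
Hypothesis Qtheta : Q theta.

Lemma not_in_prime2 : ~ Q 2.
Proof.
have [h hE] := half; apply: (@prime_unit _ Q _ (phi h)).
by rewrite -(rmorph_nat phi) -rmorphM hE rmorph1.
Qed.

Lemma prime_mul2 x : Q (2 * x) -> Q x.
Proof. by case/spec_prime => // /not_in_prime2. Qed.

Lemma reflection_subproof :
  even_signs (tperm i j, [ffun k => c && ((k == i) || (k == j))]).
Proof.
rewrite /even_signs (bigD1 i) //= (bigD1 j) 1?eq_sym //= !ffunE !eqxx orbT.
rewrite big1 ?addbF ?addbb // => k /andP[/negPf ki /negPf kj].
by rewrite ffunE ki kj andbF.
Qed.

(** The reflection in the root [theta]: it exchanges [eta i] with [(-1) ^+ c * eta j] and negates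
    [theta]. *)
Definition reflection : weylD n := exist (@even_signs n) _ reflection_subproof.

Lemma reflection_eta k :
  act reflection (eta k) = (-1) ^+ (c && ((k == i) || (k == j))) * eta (tperm i j k).
Proof. by rewrite act_eta /wsign /wperm /= ffunE. Qed.

Lemma reflection_neq1 : reflection != weyl1 n.
Proof.
apply/eqP => /(congr1 (fun w => wperm w i)); rewrite wperm1 /wperm /= tpermL.
by apply/eqP; rewrite eq_sym.
Qed.

Lemma reflection_congr x : divides theta (act reflection x - x).
Proof.
apply: (generated (S := fun x => divides theta (act reflection x - x))) => [|a|k].
- split=> [|y z dy dz|y z dy dz]; first by rewrite rmorph1 subrr; apply: divides0.
    rewrite rmorphB (_ : _ - _ = (act reflection y - y) + (-1) * (act reflection z - z)).
      by apply: dividesD => //; apply: dividesMl.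
    by ring.
  rewrite rmorphM (_ : _ - _ = act reflection y * (act reflection z - z) +
    z * (act reflection y - y)); last by ring.
  by apply: dividesD; apply: dividesMl.
- by rewrite act_phi subrr; apply: divides0.
have sign2 : (-1) ^+ c * (-1) ^+ c = 1 :> B by rewrite -expr2 sqrr_sign.
rewrite reflection_eta; have [->|ki] := eqVneq k i.
  by rewrite andbT tpermL; exists (-1); rewrite /theta; ring.
have [->|kj] := eqVneq k j; last first.
  by rewrite andbF mul1r tpermD 1?eq_sym // subrr; apply: divides0.
rewrite andbT tpermR; exists ((-1) ^+ c); rewrite /theta mulrBl mulrAC sign2; ring.
Qed.

(** Since [Q] contains [sqr_diff (wperm w k) k], the element [w] moves no index except possibly by
    exchanging [i] and [j]. A sign at a fixed index would put [2 * eta k] in [Q]. If [i] and [j] are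
    exchanged, comparison with [theta] determines both signs. *)
Lemma inertia w : (forall k, Q (act w (eta k) - eta k)) -> w = weyl1 n \/ w = reflection.
Proof.
move=> wQ.
have Qsqr k : Q (sqr_diff (wperm w k) k).
  have -> : sqr_diff (wperm w k) k = (act w (eta k) - eta k) * (act w (eta k) + eta k).
    by rewrite -subr_sqr -rmorphXn act_sqr.
  exact: ideal_mulr.
have fixp k : k != i -> k != j -> wperm w k = k.
  move=> /negPf ki /negPf kj; apply/eqP; apply: contrapT => /negP ne.
  by have := Q_other (Qsqr k) ne; rewrite ki kj !andbF.
have fixs k : wperm w k = k -> wsign w k = false.
  move=> wk; apply/negP => sk; apply: (nQeta (k := k)); apply: prime_mul2.
  have := wQ k; rewrite act_eta wk sk => /(ideal_mull (-1)).
  by rewrite (_ : -1 * _ = 2 * eta k) //; ring.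
have [wi|wi] := eqVneq (wperm w i) i.
  left; have wj : wperm w j = j.
    apply/eqP; apply: contrapT => /negP ne.
    have := Q_other (Qsqr j) ne; rewrite eqxx andbT (eq_sym j i) (negPf ij) andbF orbF.
    by move=> /eqP e; case/eqP: ij; apply: (@perm_inj _ (wperm w)); rewrite wi e.
  have wk k : wperm w k = k.
    have [->//|ki] := eqVneq k i; have [->//|kj] := eqVneq k j; exact: fixp.
  by apply: weyl_eq => k; rewrite ?wperm1 ?wsign1; [apply: wk | apply: fixs].
right; have wij : wperm w i = j.
  have := Q_other (Qsqr i) wi; rewrite (negPf ij) andbF /= => /andP[/eqP //].
have wji : wperm w j = i.
  have ne : wperm w j != j.
    by apply: contra ij => /eqP e; apply/eqP/(@perm_inj _ (wperm w)); rewrite wij e.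
  have := Q_other (Qsqr j) ne; rewrite (eq_sym j i) (negPf ij) andbF eqxx andbT /=.
  by rewrite orbF => /eqP.
have signP (b b' : bool) (x y : B) :
    ~ Q y -> Q (x - (-1) ^+ b * y) -> Q (x - (-1) ^+ b' * y) -> b = b'.
  move=> nQy Qb Qc; apply: contrapT => /eqP ne; apply: nQy; apply: prime_mul2.
  have := idealB Qb Qc; rewrite (_ : _ - _ = ((-1) ^+ b' - (-1) ^+ b) * y); last by ring.
  case: b b' ne {Qb Qc} => [] [] // _; rewrite expr0 expr1.
    by rewrite opprK.
  move=> /(ideal_mull (-1)); rewrite (_ : -1 * _ = 2 * y) //; ring.
have si : wsign w i = c.
  apply: (signP _ _ (eta i) (eta j)) => //.
  have := wQ i; rewrite act_eta wij => /(ideal_mull (-1)).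
  by rewrite (_ : -1 * _ = eta i - (-1) ^+ wsign w i * eta j) //; ring.
have sj : wsign w j = c.
  apply: (signP _ _ (eta i) (eta j)) => //.
  have := wQ j; rewrite act_eta wji => /(ideal_mull ((-1) ^+ wsign w j)).
  rewrite (_ : _ * _ = eta i - (-1) ^+ wsign w j * eta j) // mulrBr mulrA.
  by rewrite -expr2 sqrr_sign mul1r.
apply: weyl_eq => k.
  rewrite {2}/wperm /=; have [->|ki] := eqVneq k i; first by rewrite tpermL.
  have [->|kj] := eqVneq k j; first by rewrite tpermR.
  by rewrite tpermD 1?eq_sym // fixp.
rewrite {2}/wsign /= ffunE; have [->|ki] := eqVneq k i; first by rewrite si andbT.
have [->|kj] := eqVneq k j; first by rewrite sj andbT.
by rewrite andbF fixs // fixp.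
Qed.

Hypothesis Q_base : forall p, Q (phi p) -> divides_at Q theta (phi p).

(* [q] is recovered modulo [theta] from traces of multiples of [q], which lie in
   [Q] and in the base ring. *)
Lemma conjugates_ramified q : (forall w, Q (act w q)) -> divides_at Q theta q.
Proof.
move=> qQ; pose ker := [pred w : weylD n | (w != weyl1 n) && (w != reflection)].
have /choice[k kP] : forall w, exists k, ker w -> ~ Q (act w (eta k) - eta k).
  move=> w; have [kw|nkw] := boolP (ker w); last by exists i.
  apply: contrapT => nok; move: kw; suff [->|->] : w = weyl1 n \/ w = reflection.
  - by rewrite /= eqxx.
  - by rewrite /= eqxx andbF.
  by apply: inertia => k; apply: contrapT => nQ; apply: nok; exists k.
(* Interpolation off the inertia group: [g] vanishes at every element other than [weyl1 n] and
   [reflection], and its value at the identity is outside [Q]. *)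
pose g v := \prod_(w | ker w) (act w (eta (k w)) - act v (eta (k w))).
have tg : tensor g.
  apply: tensor_prod => w.
  by apply: tensorB; [apply: tensor_const | apply: tensor_act].
have g0 v : ker v -> g v = 0 by move=> kv; rewrite /g (bigD1 v) //= subrr mul0r.
have g1 : ~ Q (g (weyl1 n)).
  rewrite /g; elim/big_ind: _ => [|x y nx ny|w /kP]; first exact: spec_proper.
    by case/spec_prime.
  by rewrite act1.
have gtau : divides theta (g reflection - g (weyl1 n)).
  have [s sE] := tg; rewrite !sE -sumrB; apply: divides_sum => p _.
  by rewrite act1 -mulrBr; apply/dividesMl/reflection_congr.
have sumE : \sum_w g w * act w q = g (weyl1 n) * q + g reflection * act reflection q.
  rewrite (bigD1 (weyl1 n)) // (bigD1 reflection reflection_neq1) act1 big1 => [|w kw].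
    by congr (_ + _); apply: addr0.
  by rewrite g0 ?mul0r.
have div_sum : divides_at Q theta (\sum_w g w * act w q).
  have [s ->] := sum_tensor q tg; apply: (@ideal_sum _ (Ideal (divides_at_ideal Q theta))).
  move=> p _; apply: (@ideal_mull _ (Ideal (divides_at_ideal Q theta))) => /=.
  have [a aE] := trace_image (p.2 * q); rewrite aE; apply: Q_base; rewrite -aE.
  by apply: ideal_sum => w _; rewrite rmorphM; apply: ideal_mull.
apply: (@divides_at_cancel _ _ (2 * g (weyl1 n))).
  by case/spec_prime => // /not_in_prime2.
(* The two surviving terms of the sum are congruent modulo [theta], because [reflection] acts
   trivially there. *)
have -> : 2 * g (weyl1 n) * q = \sum_w g w * act w q -
   ((g reflection - g (weyl1 n)) * act reflection q + g (weyl1 n) * (act reflection q - q)).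
  by rewrite sumE; ring.
apply: (@idealB _ (Ideal (divides_at_ideal Q theta))) => //=.
apply: divides_atW; apply: dividesD; first exact: dividesMr.
by apply/dividesMl/reflection_congr.
Qed.

Lemma theta_uniformizer q : Q q -> divides_at Q theta q.
Proof.
have [x nQx xQ] := conjugate_avoidance Q.
by move=> /xQ /conjugates_ramified; apply: divides_at_cancel.
Qed.

End Reflection.

(** Here [jacobian] is [theta] times an element outside [Q]: the cofactor [theta'] is outside
    because [theta + theta' = 2 * eta i], the other factors by uniqueness. *)
Lemma jacobian_uniformizer (Q : spec B) : Q jacobian -> (forall k, ~ Q (eta k)) ->
  (forall p p' : 'I_n * 'I_n, (p.1 < p.2)%N -> (p'.1 < p'.2)%N ->
     Q (sqr_diff p.1 p.2) -> Q (sqr_diff p'.1 p'.2) -> p = p') ->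
  (forall p, Q (phi p) -> divides_at Q (phi delta) (phi p)) ->
  forall q, Q q -> divides_at Q jacobian q.
Proof.
move=> QJ nQeta Quniq Qbase.
have [[i j] /= lt Qij] : exists2 p : 'I_n * 'I_n, (p.1 < p.2)%N & Q (sqr_diff p.1 p.2).
  apply: contrapT => nop; move: QJ; rewrite /jacobian; elim/big_ind: _.
  - exact: spec_proper.
  - by move=> x y nx ny /spec_prime[].
  - by move=> p lt Qp; apply: nop; exists p.
have ij : i != j by rewrite neq_ltn lt.
have Q_other k l : Q (sqr_diff k l) -> k != l -> (k == i) && (l == j) || (k == j) && (l == i).
  rewrite neq_ltn => Qkl /orP[lt'|lt'].
    by have [-> ->] := Quniq (k, l) (i, j) lt' lt Qkl Qij; rewrite !eqxx.
  have Qlk : Q (sqr_diff l k) by rewrite /sqr_diff -opprB; apply: idealN.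
  by have [-> ->] := Quniq (l, k) (i, j) lt' lt Qlk Qij; rewrite !eqxx orbT.
have [c Qtheta] : exists c : bool, Q (eta i - (-1) ^+ c * eta j).
  move: Qij; rewrite /sqr_diff subr_sqr => /spec_prime[Qd|Qs].
    by exists false; rewrite mul1r.
  by exists true; rewrite expr1 mulN1r opprK.
set theta := _ - _ in Qtheta; pose theta' := eta i + (-1) ^+ c * eta j.
have thetaE : sqr_diff i j = theta * theta'.
  by rewrite -subr_sqr exprMn sqrr_sign mul1r.
have nQtheta' : ~ Q theta'.
  move=> Qt'; apply: (nQeta i); apply: prime_mul2.
  by have := idealD Qtheta Qt'; rewrite (_ : theta + theta' = 2 * eta i) // /theta /theta'; ring.
pose J' := \prod_(p : 'I_n * 'I_n | (p.1 < p.2)%N && (p != (i, j))) sqr_diff p.1 p.2.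
have JE : jacobian = sqr_diff i j * J' by rewrite /jacobian (bigD1 (i, j)).
have nQJ' : ~ Q J'.
  rewrite /J'; elim/big_ind: _ => [|x y nx ny /spec_prime[]//|p /andP[lt' ne] Qp].
    exact: spec_proper.
  by case/eqP: ne; apply: (Quniq p (i, j)).
have Qbase' p : Q (phi p) -> divides_at Q theta (phi p).
  move=> /Qbase[s nQs ds]; exists s => //.
  apply: divides_trans ds; apply: divides_trans (sqr_diff_divides ij).
  by rewrite -/(sqr_diff i j) thetaE; apply: dividesMr; apply: divides_refl.
move=> q /(theta_uniformizer ij nQeta Q_other Qtheta Qbase')[x nQx [e xq]].
exists (theta' * J' * x); first by case/spec_prime => // /spec_prime[].
by exists e; rewrite -(mulrA _ x q) xq JE thetaE /theta; ring.
Qed.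

(** * Integral closedness from height one primes, and normality *)

Section IntegralClosure.

(** For [u = 4 ^+ n], [disc] is the reduced discriminant. The hypothesis [separated] is what the
    codimension of [E] gives at primes of height one. *)
Variable u : A.
Let disc := u * alpha * delta.

Hypotheses (noeA : noetherian A) (normA : normal A).
Hypotheses (sqf_disc : squarefree disc) (disc_reg : GRing.lreg disc).
Hypothesis separated : forall (P : spec A) (Q : spec B), height_one P ->
  (forall c, P c <-> Q (phi c)) ->
  forall p p' : 'I_n * 'I_n, (p.1 < p.2)%N -> (p'.1 < p'.2)%N ->
  Q (sqr_diff p.1 p.2) -> Q (sqr_diff p'.1 p'.2) -> p = p'.

Section HeightOne.

Variable P : spec A.
Hypotheses (P_ht1 : height_one P) (Pdelta : P delta).

(** Having both [alpha] and [delta] in [P] would give [disc] a valuation of at least two. *)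
Let nPalpha : ~ P alpha.
Proof.
move=> Palpha; have Pdisc : P disc by apply: ideal_mull.
have [s nPs [e se]] := squarefree_uniformizer sqf_disc P_ht1 Pdisc Palpha.
apply: nPs; suff -> : s = u * delta * e by apply/ideal_mulr/ideal_mull.
have alpha_reg : GRing.lreg alpha.
  by have := disc_reg; rewrite /disc mulrAC => /GRing.lregMl.
by apply: alpha_reg; rewrite mulrC se /disc; ring.
Qed.

Let P_delta x : P x -> divides_at P delta x.
Proof.
have Pdisc : P disc by apply: ideal_mull.
move=> /(squarefree_uniformizer sqf_disc P_ht1 Pdisc)[s nPs [e se]].
by exists s => //; rewrite se /disc; exists (u * alpha * e); ring.
Qed.

(** Otherwise some prime [Q] contains [colon jacobian r] and avoids the image of the complement of
    [P]. It lies over [P] and contains [r]; as [jacobian] generates [Q] locally, an element outside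
    [Q] lies in the colon ideal. *)
Lemma reduced_mod_jacobian r s : ~ P s -> divides jacobian (phi s * r ^+ 2) ->
  exists2 s', ~ P s' & divides jacobian (phi s' * r).
Proof.
move=> nPs sr; apply: contrapT => nos'.
have [|||Q JQ QS] := @prime_avoiding _ (Ideal (colon_ideal jacobian r))
  (fun y => exists2 s', ~ P s' & y = phi s').
- by exists 1; [exact: spec_proper | rewrite rmorph1].
- by move=> _ _ [a na ->] [b nb ->]; exists (a * b); [case/spec_prime | rewrite rmorphM].
- by move=> x /= ds [s' ns' e]; apply: nos'; exists s' => //; rewrite -e.
have nQphi c : ~ P c -> ~ Q (phi c) by move=> nPc /QS; apply; exists c.
have QJ : Q jacobian by apply: JQ; apply: dividesMr; apply: divides_refl.
have Qdelta : Q (phi delta).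
  have [k /(ideal_divides QJ) /prime_exp] := jacobian_delta; exact.
have QP c : P c <-> Q (phi c).
  split=> [Pc|Qc]; last by apply: contrapT => /nQphi.
  have [t nPt [e te]] := P_delta Pc.
  have /spec_prime[/(nQphi _ nPt)//|//] : Q (phi t * phi c).
  by rewrite -rmorphM te rmorphM; apply: ideal_mulr.
have nQeta k : ~ Q (eta k).
  move=> Qk; apply: nPalpha; apply/QP; rewrite -eta_prod (bigD1 k) //=.
  exact: ideal_mulr.
have Qbase p : Q (phi p) -> divides_at Q (phi delta) (phi p).
  move=> /QP/P_delta[t nPt [e te]]; exists (phi t); first exact: nQphi.
  by exists (phi e); rewrite -!rmorphM te.
have Qr : Q r.
  have /spec_prime[/(nQphi _ nPs)//|/prime_exp//] : Q (phi s * r ^+ 2).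
  exact: ideal_divides sr.
have [x nQx xr] := jacobian_uniformizer QJ nQeta (separated P_ht1 QP) Qbase Qr.
by apply: nQx; apply: JQ.
Qed.

(** Descent on the exponent [m] of [jacobian]. With denominators prime to [P] omitted,
    [J ^+ m.+1 * b = d * r] and [J ^+ m.+1 * b ^+ 2 = d ^+ 2 * r'] give [r ^+ 2 = J ^+ m.+1 * r'];
    so [J] divides [r] at [P], and one factor [J] cancels. *)
Lemma closed_at_height_one (d : A) (b : B) : GRing.lreg d ->
  integral_quotient (phi d) b -> exists2 s, ~ P s & divides (phi d) (phi s * b).
Proof.
have [m mP] := conductor_exponent normA.
(* All fractions are kept in the statement, since the descent applies it to the square of the given
   one. *)
have {mP} : forall (d : A) (b : B), GRing.lreg d -> integral_quotient (phi d) b ->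
    exists2 s, ~ P s & divides (phi d) (phi s * jacobian ^+ m * b).
  move=> d' b' regd' intb'; exists 1; first exact: spec_proper.
  by rewrite rmorph1 mul1r; apply: mP.
elim: m d b => [|m IHm] d b mP regd intb.
  by have [s nPs] := mP d b regd intb; rewrite mulr1; exists s.
apply: IHm => // {}d {}b {}regd {}intb.
have [s nPs [r rE]] := mP d b regd intb.
have regdd : GRing.lreg (d * d) by apply: lregM.
have intbb : integral_quotient (phi (d * d)) (b * b).
  by rewrite rmorphM; apply: integral_quotient_mul => //; apply: phi_lreg.
have [s' nPs' [r' rE']] := mP _ _ regdd intbb.
have sr : divides jacobian (phi s' * r ^+ 2).
  suff -> : phi s' * r ^+ 2 = phi s ^+ 2 * jacobian ^+ m.+1 * r'.
    by rewrite [jacobian ^+ _]exprS; exists (phi s ^+ 2 * jacobian ^+ m * r'); ring.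
  apply: (phi_lreg regdd); rewrite [RHS]mulrCA -rE'.
  transitivity (phi s' * (phi d * r) ^+ 2); first by rewrite rmorphM; ring.
  by rewrite -rE; ring.
have [t nPt [e te]] := reduced_mod_jacobian nPs' sr.
exists (t * s); first by case/spec_prime.
exists e; apply: jacobian_lreg; transitivity (phi t * (phi s * jacobian ^+ m.+1 * b)).
  by rewrite rmorphM [jacobian ^+ m.+1]exprS; ring.
by rewrite rE mulrCA te; ring.
Qed.

End HeightOne.

Lemma integrally_closed (d : A) (b : B) : GRing.lreg d ->
  integral_quotient (phi d) b -> divides (phi d) b.
Proof.
move=> regd intb; have [bs [i1 [_ spanb freeb]]] := basis_exists.
have coord (c : 'I_N -> A) : divides (phi d) (\sum_i phi (c i) * bs i) ->
    forall i, divides d (c i).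
  move=> [e eE] i; have [c' c'E] := spanb e; exists (c' i).
  apply/eqP; rewrite -subr_eq0; apply/eqP.
  apply: (freeb (fun i => c i - d * c' i)).
  under eq_bigr => k _ do rewrite rmorphB rmorphM mulrBl -mulrA.
  by rewrite sumrB -mulr_sumr -c'E eE subrr.
have scale s (c : 'I_N -> A) :
    phi s * (\sum_i phi (c i) * bs i) = \sum_i phi (s * c i) * bs i.
  by rewrite mulr_sumr; apply: eq_bigr => i _; rewrite rmorphM mulrA.
have [c cE] := spanb b.
have [alld|] := pselect (forall i, divides d (c i)).
  rewrite cE; apply: divides_sum => i _; apply: dividesMr.
  by have [e ->] := alld i; exists (phi e); rewrite rmorphM.
move=> /existsNP[i ndi]; exfalso.
have [P [y [ndy PE]]] := associated_prime noeA ndi.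
have P_ht1 := associated_prime_height_one noeA normA regd ndy PE.
have PcE s : divides d (s * c i) -> P s.
  by move=> ds; apply/PE; rewrite mulrCA; apply: dividesMl.
(* A power of [delta] is a multiple of [jacobian ^+ m], so it brings [b], and hence its coordinate
   [c i], into the multiples of [d]. *)
have Pdelta : P delta.
  have [m mP] := conductor_exponent normA; have [k [e kE]] := jacobian_delta.
  apply: (@prime_exp _ _ _ (k * m)); apply: PcE.
  apply: (coord (fun i => delta ^+ (k * m) * c i)); rewrite -scale -cE.
  rewrite rmorphXn exprM kE exprMn mulrAC; apply: dividesMr; exact: mP.
have [s nPs] := closed_at_height_one P_ht1 Pdelta regd intb.
rewrite cE scale => /coord/(_ i)/PcE; exact: nPs.
Qed.

(** On the component [eps] of the prime below [Q], [e] is the idempotent of the support of [x]. Take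
    a monic equation [q] of [x] and its lowest coefficient, of index [k], that is nonzero at this
    prime. As [B] is reduced, the factor [x ^+ k] may be lowered to [x], so
    [x * (h0 * x + phi q_k) = 0] on the component. Then [b = - x' * h0] satisfies
    [b ^+ 2 = phi d * b], and [e = b / d] is integral, hence in [B]. *)
Lemma support_idempotent (Q : spec B) (x : B) :
  exists (eps d : A) (e h : B), [/\ ~ Q (phi eps), GRing.lreg d, e * e = e,
    phi eps * x * e = phi eps * x & phi d * e = phi eps * x * h].
Proof.
have idP : is_ideal (fun a => Q (phi a)).
  split=> [|a b Qa Qb|a b Qb]; first by rewrite rmorph0; apply: ideal0.
  - by rewrite rmorphD; apply: idealD.
  - by rewrite rmorphM; apply: ideal_mull.
pose P : spec A := @Spec _ (Ideal idP)
  (fun P1 => @spec_proper _ Q (eq_ind _ Q P1 _ (rmorph1 phi)))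
  (fun a b Pab => @spec_prime _ Q _ _ (eq_ind _ Q Pab _ (rmorphM phi a b))).
have [q mon_q qx0] := integral_over_base x.
have exk : exists k, `[< ~ zero_at P q`_k >].
  exists (size q).-1; apply/asboolP; rewrite -lead_coefE (monicP mon_q).
  by move/zero_atW/spec_proper.
pose k := ex_minn exk.
have [nzk mink] : ~ zero_at P q`_k /\ forall i, (i < k)%N -> zero_at P q`_i.
  rewrite /k; case: ex_minnP => m /asboolP nz mmin; split=> // i lt.
  apply: contrapT => nzi; have := mmin i (asboolT nzi); by rewrite leqNgt lt.
have [eps [nPeps eps_idem epsK]] := component_idempotent noeA normA P.
pose d := eps * q`_k + (1 - eps).
have regd : GRing.lreg d by apply: (regularize normA nPeps).
have ee : eps * eps = eps.
  by apply/esym/eqP; rewrite -subr_eq0 -{1}[eps]mulr1 -mulrBr eps_idem.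
pose h0 := (map_poly phi (drop_poly k.+1 q)).[x].
pose r := h0 * x + phi q`_k.
pose x' := phi eps * x.
have epsr : phi eps * x ^+ k * r = 0.
  have dropE : drop_poly k q = drop_poly k.+1 q * 'X + (q`_k)%:P.
    apply/polyP => i; rewrite coefD coefMX coefC !coef_drop_poly.
    by case: i => [|i] /=; rewrite ?add0r ?addr0 ?add0n // addSnnS.
  have takeE : phi eps * (map_poly phi (take_poly k q)).[x] = 0.
    rewrite (@horner_coef_wide _ k); last first.
      by rewrite (leq_trans (size_poly _ _)) // size_take_poly.
    rewrite mulr_sumr big1 // => i _; rewrite coef_map coef_take_poly ltn_ord.
    by rewrite mulrA -rmorphM epsK ?rmorph0 ?mul0r //; apply: mink.
  have : phi eps * (map_poly phi q).[x] = 0 by rewrite qx0 mulr0.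
  rewrite -{1}(poly_take_drop k q) rmorphD rmorphM /= map_polyXn hornerD hornerM.
  rewrite mulrDr takeE add0r hornerXn dropE rmorphD rmorphM /= map_polyX map_polyC.
  by rewrite hornerD hornerM hornerX hornerC -/h0 => <-; rewrite /r; ring.
have x'r : x' * r = 0.
  apply: (extension_reduced normA (k := k.+1)); rewrite exprMn.
  transitivity (phi eps ^+ k * x * r ^+ k * (phi eps * x ^+ k * r)).
    by rewrite /x' exprMn !exprS; ring.
  by rewrite epsr mulr0.
pose b := - (x' * h0).
have x'eps : x' * phi eps = x'.
  by rewrite /x' mulrAC -rmorphM ee.
have x'd : x' * phi d = x' * b.
  have -> : x' * phi d = x' * phi q`_k.
    have epsd : phi eps * phi d = phi eps * phi q`_k.
      by rewrite -!rmorphM /d mulrDr eps_idem mulrA ee addr0.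
    transitivity (x' * phi eps * phi d); first by rewrite x'eps.
    by rewrite -[LHS]mulrA epsd [LHS]mulrA x'eps.
  have -> : x' * b = - (x' * h0 * x).
    by rewrite /b -[in RHS]x'eps /x'; ring.
  by move/eqP: x'r; rewrite /r mulrDr addrC addr_eq0 mulrA => /eqP.
have bb : b ^+ 2 = phi d * b.
  transitivity (- (h0 * (x' * b))); first by rewrite expr2 {1}/b; ring.
  by rewrite -x'd /b; ring.
have intb : integral_quotient (phi d) b.
  exists 2, (fun i => (i == 1)%:R); rewrite big_ord_recl big_ord1 /= mul0r mul0r add0r.
  by rewrite bb mul1r.
have [e bE] := integrally_closed regd intb.
have regphi := phi_lreg regd.
exists eps, d, e, (- h0); split=> //.
- apply: (regphi); apply: (regphi).
  by transitivity (b ^+ 2); [rewrite bE | rewrite bb bE]; ring.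
- by apply: regphi; rewrite mulrCA -bE -/x' -x'd mulrC.
- by rewrite -bE /b -/x'; ring.
Qed.

(** If [x * y] vanishes at [Q], the support idempotent [e] of [x] kills [y], and either [e] or
    [1 - e] is outside [Q]. If [y] is nonzero at [Q], its support idempotent is outside [Q] and
    [e * phi d = H * y], which turns the fraction [x / y] into [H * x / phi d], with a regular
    denominator from [A]. *)
Lemma normal_extension : normal B.
Proof.
move=> Q; apply: normal_domain_loc_at => [x y [s nQs sxy]|y x nzy intx].
  have [eps [d [e [h [nQeps regd ee xe de]]]]] := support_idempotent Q (s * x).
  have ey : e * y = 0.
    apply: (phi_lreg regd); rewrite mulrA de mulr0.
    by transitivity (phi eps * h * (s * (x * y))); [ring | rewrite sxy mulr0].
  have [Qe|nQe] := pselect (Q e); last by right; exists e.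
  left; exists ((1 - e) * (phi eps * s)).
    move=> /spec_prime[Q1e|/spec_prime[]//].
    by apply: (@spec_proper _ Q); rewrite -(subrK e 1); apply: idealD.
  rewrite mulrBl mul1r mulrBl -[phi eps * s * x]mulrA -xe.
  by rewrite -!mulrA [e * _]mulrC; ring.
have [eps [d [e [h [nQeps regd ee ye de]]]]] := support_idempotent Q y.
have nQe : ~ Q e.
  move=> Qe; apply: nzy; exists ((1 - e) * phi eps).
    move=> /spec_prime[Q1e|//].
    by apply: (@spec_proper _ Q); rewrite -(subrK e 1); apply: idealD.
  by rewrite -mulrA mulrBl mul1r -{1}ye mulrC subrr.
pose H := phi eps * h.
have HE : e * phi d = H * y by rewrite mulrC de /H; ring.
have intH : integral_quotient (phi d) (H * x).
  by apply: (@integral_quotient_weaken _ e); rewrite HE; apply: integral_quotient_scale.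
have [c cE] := integrally_closed regd intH.
exists e => //; exists c; apply: (phi_lreg regd).
transitivity (y * (H * x)); last by rewrite cE; ring.
by rewrite mulrA [phi d * e]mulrC HE; ring.
Qed.

End IntegralClosure.

End TypeDExtension.

(** * Polynomials *)

(** The quotient of the polynomial ring by [p]; constants are reduced modulo [p], whose degree is
    positive. *)
Lemma adjoin_root (R : comNzRingType) (p : {poly R}) :
  p \is monic -> (1 < size p)%N ->
  exists (R' : comNzRingType) (h : {rmorphism R -> R'}) (x : R'),
    injective h /\ (map_poly h p).[x] = 0.
Proof.
move=> mon_p szp; have mkE : mk_monic p = p by rewrite /mk_monic szp mon_p.
pose h : {rmorphism R -> {poly %/ p}} := in_qpoly p \o polyC.
exists {poly %/ p}, h, (in_qpoly p 'X); split.
  have hE c : h c = c%:P :> {poly R}.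
    by apply: in_qpoly_small; rewrite mkE (leq_ltn_trans (size_polyC_leq1 c)).
  by move=> c d /(congr1 (@qpoly.polyn _ _)); rewrite !hE => /polyC_inj.
rewrite map_poly_comp horner_map; have -> : (map_poly polyC p).['X] = p.
  by rewrite -[RHS]comp_polyXr.
apply: val_inj => /=; rewrite mkE; exact: Pdiv.RingMonic.rmodpp.
Qed.

Lemma split_monic (m : nat) (R : comNzRingType) (p : {poly R}) :
  p \is monic -> size p = m.+1 ->
  exists (R' : comNzRingType) (h : {rmorphism R -> R'}) (t : seq R'),
    [/\ injective h, size t = m & map_poly h p = \prod_(x <- t) ('X - x%:P)].
Proof.
elim: m R p => [|m IHm] R p mon_p szp.
  exists R, idfun, [::]; split=> //; rewrite big_nil map_poly_id //.
  have := monicP mon_p; rewrite lead_coefE szp /= => p0.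
  by rewrite [p]size1_polyC ?szp // p0.
have [|R1 [h1 [x [inj1 /rootP px]]]] := adjoin_root mon_p; first by rewrite szp.
have [q qE] := factor_theorem _ _ px.
have mon_q : q \is monic.
  by rewrite -(monicMr q (monicXsubC x)) -qE monic_map.
have szq : size q = m.+1.
  have : size (map_poly h1 p) = m.+2.
    by rewrite size_map_poly_id0 ?szp // (monicP mon_p) rmorph1 oner_eq0.
  by rewrite qE size_Mmonic ?monic_neq0 ?monicXsubC // size_XsubC addn2 => -[].
have [R2 [h2 [t [inj2 szt qt]]]] := IHm _ _ mon_q szq.
exists R2, (h2 \o h1), (h2 x :: t); split; rewrite /= ?szt //.
  exact: inj_comp.
by rewrite map_poly_comp qE rmorphM /= qt map_polyXsubC big_cons mulrC.
Qed.

Lemma adjoin_sqrts (R : comNzRingType) (t : seq R) :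
  exists (R' : comNzRingType) (h : {rmorphism R -> R'}),
    injective h /\ forall x, x \in t -> exists s, s ^+ 2 = h x.
Proof.
elim: t => [|x t [R1 [h1 [inj1 sq1]]]]; first by exists R, idfun; split.
have mon : 'X^2 - (h1 x)%:P \is monic by apply: monicXnsubC.
have [|R2 [h2 [s [inj2]]]] := adjoin_root mon; first by rewrite size_XnsubC.
rewrite rmorphB /= map_polyXn map_polyC hornerD hornerN hornerXn hornerC => /eqP.
rewrite subr_eq0 => /eqP sE.
exists R2, (h2 \o h1); split; first exact: inj_comp.
move=> y /[!inE] /orP[/eqP->|/sq1[r rE]]; first by exists s.
by exists (h2 r); rewrite -rmorphXn rE.
Qed.

Lemma coef_prod_XsubC_esym (R : comNzRingType) (n k : nat) (c : 'I_n -> R) : (k <= n)%N ->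
  (\prod_i ('X - (c i)%:P))`_(n - k) =
  (-1) ^+ k * \sum_(h : {set 'I_n} | #|h| == k) \prod_(i in h) c i.
Proof.
move=> le_kn; under eq_bigr => i _ do rewrite addrC.
rewrite bigA_distr coef_sum mulr_sumr (bigID (fun h : {set 'I_n} => #|h| == k)) /=.
have termE (h : {set 'I_n}) :
    \prod_i (if i \in h then - (c i)%:P else 'X : {poly R}) =
    ((-1) ^+ #|h| * \prod_(i in h) c i)%:P * 'X^(n - #|h|).
  rewrite (bigID (mem h)) /=; congr (_ * _).
    rewrite rmorphM rmorphXn rmorphN1 rmorph_prod -prodrN; apply: eq_bigr => i ih.
    by rewrite ih.
  rewrite (eq_bigr (fun=> 'X)); last by move=> i /negPf ->.
  have -> : (n - #|h|)%N = #|~: h| by rewrite [RHS]cardsCs finset.setCK card_ord.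
  rewrite prodr_const; congr ('X ^+ _); by apply: eq_card => i; rewrite inE.
rewrite [X in _ + X]big1 ?addr0.
  by apply: eq_bigr => h /eqP hk; rewrite termE coefCM hk coefXn eqxx mulr1.
move=> h hk; rewrite termE coefCM coefXn; case: eqP => [e|]; last by rewrite mulr0.
case/eqP: hk; have le_hn : (#|h| <= n)%N by rewrite -[leqRHS]card_ord max_card.
by rewrite -(subKn le_kn) e subKn.
Qed.

Lemma deriv_prod_XsubC (R : comNzRingType) (n : nat) (t : 'I_n -> R) i j : i != j ->
  divides (t i - t j) ((\prod_k ('X - (t k)%:P))^`()).[t i].
Proof.
move=> ij; rewrite (bigD1 i) //= (bigD1 j) 1?eq_sym //=; set r := \prod_(k | _) _.
exists r.[t i]; rewrite !derivM !derivXsubC !(hornerE, hornerM).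
by ring.
Qed.

(** The Sylvester matrix has a row with entries [c] and [0] only. This serves for polynomials with
    constant derivative. *)
Lemma resultantC_divides (R : comNzRingType) (c : R) (p : {poly R}) :
  (1 < size p)%N -> divides c (resultant c%:P p).
Proof.
move=> szp; have lt : (0 < (size p).-1)%N by rewrite -ltnS prednK // ltnW.
rewrite /resultant (expand_det_row _ (lshift _ (Ordinal lt))).
apply: divides_sum => j _; apply: dividesMr.
rewrite Sylvester_mxE; case: splitP => k /= ek; last first.
  by move/esym/eqP: ek; rewrite addn_eq0 => /andP[/eqP sz0 _]; rewrite sz0 in lt.
rewrite coefC; case: (_ == _); case: (_ <= _)%N; rewrite ?mulr0n ?mulr1n ?mul0rn;
  by [apply: divides_refl | apply: divides0].
Qed.

(** The resultant is a combination of [p] and its derivative. At the root [t i] the first vanishes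
    and the second is a multiple of [t i - t j]. *)
Lemma resultant_deriv_divides (A B : comNzRingType) (phi : {rmorphism A -> B})
    (p : {poly A}) (n : nat) (t : 'I_n -> B) i j :
  (1 < size p)%N -> map_poly phi p = \prod_k ('X - (t k)%:P) -> i != j ->
  divides (t i - t j) (phi (resultant p^`() p)).
Proof.
move=> szp pE ij; have dij := deriv_prod_XsubC t ij.
have p'E : (map_poly phi p^`()).[t i] = ((\prod_k ('X - (t k)%:P))^`()).[t i].
  by rewrite -deriv_map pE.
have [sz1|sz1] := leqP (size p^`()) 1.
  have [c cE] : exists c, p^`() = c%:P by exists p^`()`_0; apply: size1_polyC.
  apply: (@divides_trans _ _ (phi c)).
    by move: dij; rewrite -p'E cE map_polyC hornerC.
  rewrite cE; have [e ->] := resultantC_divides c szp; rewrite rmorphM.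
  by apply: dividesMr; apply: divides_refl.
have [[u v] _ /= uvE] := resultant_in_ideal sz1 szp.
have -> : phi (resultant p^`() p) = (map_poly phi (resultant p^`() p)%:P).[t i].
  by rewrite map_polyC hornerC.
rewrite uvE rmorphD !rmorphM /= hornerD !hornerM; apply: dividesD; apply: dividesMl.
  by rewrite p'E.
rewrite pE horner_prod (bigD1 i) //= hornerXsubC subrr mul0r; exact: divides0.
Qed.

(** * The type D splitting ring *)

Lemma quotient_lift (R B S : comNzRingType) (pr : {rmorphism R -> B}) (rho : {rmorphism R -> S}) :
  (forall z, exists x, z = pr x) -> (forall x, pr x = 0 -> rho x = 0) ->
  exists psi : {rmorphism B -> S}, forall x, psi (pr x) = rho x.
Proof.
move=> /choice[s sE] kerP; pose psi z := rho (s z).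
have wd x y : pr x = pr y -> rho x = rho y.
  move=> e; apply/eqP; rewrite -subr_eq0 -rmorphB; apply/eqP/kerP.
  by rewrite rmorphB e subrr.
have psiE x : psi (pr x) = rho x by apply: wd; rewrite -sE.
have zm : zmod_morphism psi.
  by move=> x y; rewrite (sE x) (sE y) -rmorphB !psiE rmorphB.
have mm : monoid_morphism psi.
  split=> [|x y]; first by rewrite -(rmorph1 pr) psiE rmorph1.
  by rewrite (sE x) (sE y) -rmorphM !psiE rmorphM.
pose F : {rmorphism B -> S} := HB.pack psi
  (GRing.isZmodMorphism.Build _ _ psi zm) (GRing.isMonoidMorphism.Build _ _ psi mm).
by exists F.
Qed.

Lemma card_full_set n (S : {set 'I_n}) : (#|S| == n) = (S == finset.setT).
Proof.
have le_Sn : (#|S| <= n)%N by rewrite -[leqRHS]card_ord max_card.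
by rewrite eqEcard finset.subsetT /= cardsT card_ord eqn_leq le_Sn.
Qed.

Section DSplit.

Variables (A : comNzRingType) (n : nat) (f : {poly A}) (alpha : A).

Hypothesis n_gt0 : (0 < n)%N.
Hypothesis dcoef0 : dcoef n f 0 = 1.
Hypothesis dcoefn : dcoef n f n = (-1) ^+ n * alpha ^+ 2.
Hypothesis alpha_reg : GRing.lreg alpha.

Local Notation I := (ideal_gen (@dsplit_rels A n f alpha)).
Local Notation p := (\sum_(i < n.+1) dcoef n f (n - i) *: 'X^i).

Lemma esym_sqE k :
  esym_sq A n k = \sum_(h : {set 'I_n} | #|h| == k) \prod_(i in h) 'X_i ^+ 2.
Proof.
rewrite /esym_sq /mesym rmorph_sum; apply: eq_bigr => h _.
rewrite rmorph_prod; apply: eq_bigr => i _.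
by rewrite /= comp_mpolyXU -tnth_nth tnth_mktuple.
Qed.

Lemma dpolyE : p = \poly_(i < n.+1) dcoef n f (n - i).
Proof. by rewrite poly_def. Qed.

Lemma size_dpoly : size p = n.+1.
Proof. by rewrite dpolyE size_poly_eq // subnn dcoef0 oner_eq0. Qed.

Lemma dpoly_monic : p \is monic.
Proof.
by rewrite monicE lead_coefE size_dpoly dpolyE coef_poly ltnSn subnn dcoef0.
Qed.

Lemma coef_dpoly k : (k <= n)%N -> p`_(n - k) = dcoef n f k.
Proof. by move=> le; rewrite dpolyE coef_poly ltnS leq_subr subKn. Qed.

Lemma dpoly_split (B : comNzRingType) (phi : {rmorphism A -> B}) (e : 'I_n -> B) :
  (forall k, (1 <= k <= n.-1)%N -> phi (dcoef n f k) =
     (-1) ^+ k * \sum_(h : {set 'I_n} | #|h| == k) \prod_(i in h) e i ^+ 2) ->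
  \prod_i e i = phi alpha ->
  map_poly phi p = \prod_i ('X - (e i ^+ 2)%:P).
Proof.
move=> rel_e prod_e; apply/polyP => j; rewrite coef_map /=.
have [lt_nj|le_jn] := ltnP n j.
  rewrite nth_default ?size_dpoly // rmorph0 nth_default //.
  rewrite -(big_enum _ _ _ (fun i => 'X - (e i ^+ 2)%:P)) size_prod_XsubC.
  by rewrite -cardE card_ord.
rewrite -(subKn le_jn); have le_kn := leq_subr j n; move: (n - j)%N le_kn => k le_kn.
rewrite coef_dpoly // (coef_prod_XsubC_esym (fun i => e i ^+ 2)) //.
have [->|k_gt0] := posnP k.
  rewrite dcoef0 rmorph1 mul1r (big_pred1 finset.set0) ?big_set0 //.
  by move=> h; rewrite cards_eq0.
(* The constant coefficient is not among the symmetric relations; it comes from squaring the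
   relation on the product. *)
have [->|ne_kn] := eqVneq k n.
  rewrite dcoefn rmorphM rmorphXn rmorphN1 rmorphXn -prod_e (big_pred1 (finset.setT)).
    by rewrite -prodrXl; congr (_ * _); apply: eq_bigl => i; rewrite !inE.
  exact: card_full_set.
by apply: rel_e; rewrite k_gt0 -ltnS prednK // ltn_neqAle ne_kn.
Qed.

(* Adjoin to [A] the roots [t] of [p] and square roots of them all but one; then
   [X], a square root of the last one, satisfies [(g X) ^ 2 = alpha ^ 2], and
   imposing [g X = alpha] kills no element of [A] since [alpha] is regular. *)
Lemma dsplit_base_inj c : I c%:MP_[n] -> c = 0.
Proof.
have [C1 [h1 [ts [inj1 szt ptE]]]] := split_monic dpoly_monic size_dpoly.
have [C [h2 [inj2 sq]]] := adjoin_sqrts ts.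
pose h : {rmorphism A -> C} := h2 \o h1.
have injh : injective h by apply: inj_comp.
pose t (i : 'I_n) := h2 ts`_i.
have /choice[s sE] : forall i, exists s, s ^+ 2 = t i.
  by move=> i; apply: sq; apply: mem_nth; rewrite szt.
have pE : map_poly h p = \prod_i ('X - (t i)%:P).
  rewrite map_poly_comp ptE (big_nth 0) szt big_mkord rmorph_prod.
  by apply: eq_bigr => i _; rewrite /= map_polyXsubC.
have dE k : (k <= n)%N -> h (dcoef n f k) =
    (-1) ^+ k * \sum_(S : {set 'I_n} | #|S| == k) \prod_(i in S) t i.
  by move=> le; rewrite -coef_dpoly // -coef_map pE coef_prod_XsubC_esym.
have prod_t : \prod_i t i = h alpha ^+ 2.
  have sgnK : (-1) ^+ n * (-1) ^+ n = 1 :> C by rewrite -exprMn mulrNN mulr1 expr1n.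
  have := dE n (leqnn n); rewrite dcoefn rmorphM !rmorphXn rmorphN1.
  move=> E; rewrite -[RHS]mul1r -sgnK -mulrA E mulrA sgnK mul1r.
  rewrite (big_pred1 (finset.setT)).
    by apply: eq_bigl => i; rewrite inE.
  exact: card_full_set.
pose i0 := Ordinal n_gt0.
pose g := \prod_(i | i != i0) s i.
have g2 : g ^+ 2 * t i0 = h alpha ^+ 2.
  rewrite -prod_t (bigD1 i0) //= mulrC -prodrXl; congr (_ * _).
  by apply: eq_bigr => i _; rewrite sE.
pose hP : {rmorphism A -> {poly C}} := polyC \o h.
pose x i : {poly C} := if i == i0 then 'X else (s i)%:P.
pose ev : {rmorphism {mpoly A[n]} -> {poly C}} := mmap hP x.
have evX i : ev 'X_i = x i by rewrite /= mmapX mmap1U.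
have evC a : ev a%:MP_[n] = (h a)%:P by rewrite /= mmapC.
pose d : {poly C} := 'X^2 - (t i0)%:P.
pose e : {poly C} := g%:P * 'X - (h alpha)%:P.
(* The preimage under [ev] of the ideal generated by [d] and [e]. *)
pose K (P : {mpoly A[n]}) := exists r, divides d (ev P - e * r).
have idK : is_ideal K.
  split=> [|P P' [r Pr] [r' Pr']|a P [r Pr]].
  - by exists 0; rewrite rmorph0 mulr0 subr0; apply: divides0.
  - exists (r + r'); rewrite rmorphD mulrDr opprD addrACA; exact: dividesD.
  - exists (ev a * r); rewrite rmorphM mulrCA -mulrBr; exact: dividesMl.
have x2 i : divides d (x i ^+ 2 - (t i)%:P).
  rewrite /x; case: eqP => [->|_]; first exact: divides_refl.
  by rewrite -rmorphXn sE subrr; apply: divides0.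
have x2prod (S : {set 'I_n}) :
    divides d (\prod_(i in S) x i ^+ 2 - (\prod_(i in S) t i)%:P).
  rewrite rmorph_prod; elim/big_rec2: _ => [|i y1 y2 _ dy].
    by rewrite subrr; apply: divides0.
  rewrite (_ : _ - _ = x i ^+ 2 * (y2 - y1) + y1 * (x i ^+ 2 - (t i)%:P)); last by ring.
  by apply: dividesD; apply: dividesMl.
have genK : (@dsplit_rels A n f alpha `<=` K)%classic.
  move=> P [[k /= /andP[k_gt0 le_k] <-]|->].
    exists 0; rewrite mulr0 subr0 rmorphB evC dE; last by rewrite (leq_trans le_k) // leq_pred.
    rewrite rmorphM rmorphXn rmorphN1 esym_sqE rmorph_sum rmorphM rmorphXn rmorphN1.
    rewrite rmorph_sum -mulrBr -sumrB; apply: dividesMl; apply: divides_sum => S _.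
    have -> : ev (\prod_(i in S) 'X_i ^+ 2) = \prod_(i in S) x i ^+ 2.
      by rewrite (rmorph_prod ev); apply: eq_bigr => i _; rewrite (rmorphXn ev) evX.
    rewrite -opprB -mulN1r; apply: dividesMl; exact: x2prod.
  exists 1; rewrite mulr1 rmorphB evC rmorph_prod (eq_bigr x) => [|i _]; last by rewrite evX.
  rewrite (bigD1 i0) //= {1}/x eqxx (eq_bigr (fun i => (s i)%:P)); last first.
    by move=> i /negPf ne; rewrite /x ne.
  by rewrite -rmorph_prod -/g mulrC subrr; apply: divides0.
move=> /(_ K idK genK) [r [q rq]].
(* The conjugate of [e]: as [d] divides [e * e'], it divides [(h c)%:P * e'], whose degree is at
   most one. So the latter is zero, and its constant coefficient is the image of [c * alpha]. *)
pose e' : {poly C} := g%:P * 'X + (h alpha)%:P.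
have ee' : e * e' = (g ^+ 2)%:P * d.
  have a2 : (h alpha)%:P ^+ 2 = g%:P ^+ 2 * (t i0)%:P.
    by rewrite -(rmorphXn (@polyC C)) -g2 rmorphM rmorphXn.
  by rewrite -subr_sqr a2 rmorphXn /d; ring.
have [w wE] : divides d ((h c)%:P * e').
  have -> : (h c)%:P * e' = d * (q * e') + (e * e') * r.
    by rewrite mulrA -rq evC; ring.
  rewrite ee'; apply: dividesD; first by apply: dividesMr; apply: divides_refl.
  by apply: dividesMr; apply: dividesMl; apply: divides_refl.
have mon_d : d \is monic by apply: monicXnsubC.
have szd : size d = 3 by rewrite size_XnsubC.
have w0 : w = 0.
  apply/eqP; apply: contrapT => /negP w_neq0.
  have := size_monicM mon_d w_neq0; rewrite -wE szd.
  have : (size ((h c)%:P * e')%R <= 2)%N.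
    rewrite mulrDr mulrA -!rmorphM; apply: (leq_trans (size_polyD _ _)).
    rewrite geq_max (leq_trans (size_polyC_leq1 _)) // andbT.
    have [->|nz] := eqVneq (h c * g) 0; first by rewrite mul0r size_poly0.
    by rewrite size_mulX ?polyC_eq0 // size_polyC nz.
  move: w_neq0; rewrite -size_poly_gt0; case: (size w) => // m _ + sz; rewrite sz.
  by rewrite addnS.
move/(congr1 (fun P : {poly C} => P`_0)): wE; rewrite w0 mulr0 coefC /= coefCM.
rewrite coefD coefCM coefX mulr0 add0r coefC /= => ca.
by apply: alpha_reg; apply: injh; rewrite mulr0 rmorph0 rmorphM mulrC.
Qed.

Section Presentation.

(** [B] stands for [DSplit] equipped with the structure of a nonzero ring, which depends on
    [dsplit_base_inj]. *)
Variables (B : comNzRingType) (pr : {rmorphism {mpoly A[n]} -> B}).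
Hypothesis pr_surj : forall z, exists x, z = pr x.
Hypothesis pr_ker : forall x, pr x = 0 <-> I x.

Let phi : {rmorphism A -> B} := pr \o @mpolyC n A.
Let root i : B := pr 'X_i.

Let rel_root k : (1 <= k <= n.-1)%N -> phi (dcoef n f k) =
  (-1) ^+ k * \sum_(h : {set 'I_n} | #|h| == k) \prod_(i in h) root i ^+ 2.
Proof.
move=> le_k; have /pr_ker : I ((dcoef n f k)%:MP_[n] - (-1) ^+ k * esym_sq A n k).
  by move=> J _; apply; left; exists k.
rewrite rmorphB => /eqP; rewrite subr_eq0 => /eqP /= ->.
rewrite rmorphM rmorphXn rmorphN1 esym_sqE rmorph_sum; congr (_ * _).
apply: eq_bigr => h _; rewrite rmorph_prod; apply: eq_bigr => i _.
by rewrite rmorphXn.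
Qed.

Let prod_root : \prod_i root i = phi alpha.
Proof.
have /pr_ker : I (\prod_(j < n) 'X_j - alpha%:MP_[n]) by move=> J _; apply; right.
by rewrite rmorphB rmorph_prod => /eqP; rewrite subr_eq0 => /eqP.
Qed.

Lemma dsplit_universal (e : 'I_n -> B) :
  (forall k, (1 <= k <= n.-1)%N -> phi (dcoef n f k) =
     (-1) ^+ k * \sum_(h : {set 'I_n} | #|h| == k) \prod_(i in h) e i ^+ 2) ->
  \prod_i e i = phi alpha ->
  exists psi : {rmorphism B -> B},
    (forall a, psi (phi a) = phi a) /\ (forall i, psi (root i) = e i).
Proof.
move=> rel_e prod_e; pose rho : {rmorphism {mpoly A[n]} -> B} := mmap phi e.
have rhoX i : rho 'X_i = e i by rewrite /= mmapX mmap1U.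
have rhoC a : rho a%:MP_[n] = phi a by rewrite /= mmapC.
have rhoI x : pr x = 0 -> rho x = 0.
  move/pr_ker/(_ (fun P => rho P = 0)); apply; first split=> [|P P' P0 P'0|a P P0].
  - by rewrite rmorph0.
  - by rewrite rmorphD P0 P'0 addr0.
  - by rewrite rmorphM P0 mulr0.
  move=> P [[k /= le_k <-]|->].
    rewrite rmorphB rhoC rel_e // (rmorphM rho) (rmorphXn rho) rmorphN1 esym_sqE.
    rewrite (rmorph_sum rho) -mulrBr -sumrB big1 ?mulr0 // => h _.
    rewrite (rmorph_prod rho); apply/eqP; rewrite subr_eq0; apply/eqP.
    by apply: eq_bigr => i _; rewrite (rmorphXn rho) rhoX.
  rewrite rmorphB rhoC (rmorph_prod rho) -prod_e; apply/eqP; rewrite subr_eq0.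
  by apply/eqP/eq_bigr => i _; rewrite rhoX.
have [psi psiE] := quotient_lift pr_surj rhoI.
by exists psi; split=> [a|i]; rewrite psiE ?rhoX ?rhoC.
Qed.

(** Signed permutations permute the squares of the roots, hence respect the symmetric relations; an
    even number of signs preserves the product. *)
Lemma dsplit_weyl_action : exists act : weylD n -> {rmorphism B -> B},
  (forall w a, act w (phi a) = phi a) /\
  (forall w i, act w (root i) = (-1) ^+ wsign w i * root (wperm w i)).
Proof.
have /choice[act actP] : forall w : weylD n, exists psi : {rmorphism B -> B},
    (forall a, psi (phi a) = phi a) /\
    (forall i, psi (root i) = (-1) ^+ wsign w i * root (wperm w i)).
  move=> w; pose e i := (-1) ^+ wsign w i * root (wperm w i).
  have e2 i : e i ^+ 2 = root (wperm w i) ^+ 2 by rewrite exprMn sqrr_sign mul1r.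
  apply: (@dsplit_universal e) => [k le_k|].
    have le_kn : (k <= n)%N.
      by case/andP: le_k => _ le_k; rewrite (leq_trans le_k) // leq_pred.
    have eE : \prod_i ('X - (e i ^+ 2)%:P) = \prod_i ('X - (root i ^+ 2)%:P).
      rewrite [RHS](reindex_inj (@perm_inj _ (wperm w))) /=.
      by apply: eq_bigr => i _; rewrite e2.
    rewrite rel_root // -(coef_prod_XsubC_esym (fun i => root i ^+ 2)) //.
    by rewrite -(coef_prod_XsubC_esym (fun i => e i ^+ 2)) // eE.
  rewrite /e big_split -prod_root [RHS](reindex_inj (@perm_inj _ (wperm w))) /=.
  have -> : \prod_i (-1 : B) ^+ wsign w i = (-1) ^+ (\big[addb/false]_i wsign w i : bool).
    by elim/big_rec2: _ => // i x y _ ->; rewrite signr_addb.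
  by rewrite (negPf (valP w)) mul1r.
by exists act; split=> w; have [] := actP w.
Qed.

Lemma dsplit_generated (S : B -> Prop) : is_subring S ->
  (forall a, S (phi a)) -> (forall i, S (root i)) -> forall x, S x.
Proof.
move=> subS Sphi Sroot x; have [P ->] := pr_surj x.
elim/mpolyind: P => [|c m P _ _ SP]; first by rewrite rmorph0; apply: subring0.
rewrite rmorphD; apply: subringD => //; rewrite -mul_mpolyC rmorphM.
apply: subringM => //; first exact: Sphi.
rewrite mpolyXE_id rmorph_prod; elim/big_ind: _ => [|y z|i _].
- exact: subring1.
- exact: subringM.
- by rewrite rmorphXn; apply: subringX => //; apply: Sroot.
Qed.

Lemma dsplit_normal : invertible (2 : A) -> noetherian A -> normal A ->
  squarefree (reduced_disc n f alpha) -> GRing.lreg (reduced_disc n f alpha) ->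
  (forall (P : spec A) (Q : spec B), height_one P ->
     (forall c, P c <-> Q (phi c)) ->
     forall p p' : 'I_n * 'I_n, (p.1 < p.2)%N -> (p'.1 < p'.2)%N ->
     Q (root p.1 ^+ 2 - root p.2 ^+ 2) -> Q (root p'.1 ^+ 2 - root p'.2 ^+ 2) ->
     p = p') ->
  normal B.
Proof.
move=> half noeA normA sqf reg sep; have [act [act_phi act_root]] := dsplit_weyl_action.
have phi_inj : injective phi.
  move=> a b e; have ab0 : phi (a - b) = 0 by rewrite rmorphB e subrr.
  by apply/eqP; rewrite -subr_eq0; apply/eqP/dsplit_base_inj/pr_ker.
have pE := dpoly_split rel_root prod_root.
apply: (@normal_extension A B phi n root act alpha (tilde_disc n f) n_gt0 act_phi
  act_root dsplit_generated phi_inj half prod_root _ _ _ (4 ^+ n) noeA normA sqf reg sep).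
- by move=> k; rewrite -pE coef_map; eexists.
- exact: GRing.lregMl reg.
- move=> i j ij; rewrite /tilde_disc /monic_disc rmorphM; apply: dividesMl.
  by apply: resultant_deriv_divides pE ij; rewrite size_dpoly.
Qed.

End Presentation.

End DSplit.

Theorem proposition3p6 (A : comNzRingType) (n : nat) (a : nat -> A)
  (f : {poly A}) (alpha : A) :
  noetherian A ->
  invertible (2 : A) ->
  (1 <= n)%N ->
  a 0%N = 1 ->
  f = \sum_(i < n.+1) a (2 * n - 2 * i)%N *: 'X^(2 * i) ->
  alpha ^+ 2 = (-1) ^+ n * a (2 * n)%N ->
  normal A ->
  squarefree (reduced_disc n f alpha) ->
  GRing.lreg (reduced_disc n f alpha) ->
  codim_ge (E_locus n f alpha) 2 ->
  normal (DSplit n f alpha).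
Proof.
move=> noeA half n_gt0 a0 fE alpha2 normA sqf reg codimE.
have coef_f k : (k <= n)%N -> dcoef n f k = a (2 * k)%N.
  move=> le_kn; rewrite /dcoef fE coef_sum.
  have lt : (n - k < n.+1)%N by rewrite ltnS leq_subr.
  have -> : (2 * n - 2 * k = 2 * (n - k))%N by rewrite mulnBr.
  rewrite (bigD1 (Ordinal lt)) //= coefZ coefXn eqxx mulr1 big1 ?addr0 => [|i].
    by rewrite -mulnBr subKn.
  rewrite -val_eqE /= coefZ coefXn eqn_mul2l /= eq_sym => /negPf ->.
  by rewrite mulr0.
have dcoef0 : dcoef n f 0 = 1 by rewrite coef_f.
have dcoefn : dcoef n f n = (-1) ^+ n * alpha ^+ 2.
  by rewrite coef_f // alpha2 mulrA -exprMn mulrNN mulr1 expr1n mul1r.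
have alpha_reg : GRing.lreg alpha.
  by have := reg; rewrite /reduced_disc mulrAC => /GRing.lregMl.
(* If [1] were in the ideal of relations, [dsplit_base_inj] would give [1 = 0] in [A]. *)
have one_neq0 : (1 : DSplit n f alpha) != 0.
  apply/eqP => e10; have /qproj_eq : qproj (ideal_gen (@dsplit_rels A n f alpha)) 1 = qproj _ 0.
    by rewrite rmorph0 rmorph1.
  rewrite subr0 -mpolyC1.
  move=> /(dsplit_base_inj n_gt0 dcoef0 dcoefn alpha_reg)/eqP.
  by rewrite oner_eq0.
pose B : comNzRingType := HB.pack (DSplit n f alpha : Type)
  (GRing.ComPzRing.on (DSplit n f alpha))
  (GRing.PzSemiRing_isNonZero.Build (DSplit n f alpha) one_neq0).
pose pr : {rmorphism {mpoly A[n]} -> B} := qproj (ideal_gen (@dsplit_rels A n f alpha)).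
apply: (@dsplit_normal A n f alpha n_gt0 dcoef0 dcoefn alpha_reg B pr) => //.
- by move=> z; apply: qproj_surj.
- by move=> x; rewrite -(rmorph0 pr); split=> [/qproj_eq|Ix]; [|apply/qproj_eq]; rewrite subr0.
(* Two distinct factors in [Q] place [P] in [E_locus], whose primes have height at least two. *)
move=> P Q P_ht1 PQ p p' lt lt' Qp Qp'; apply: contrapT => ne.
have [_] := P_ht1; apply; apply: codimE; exists Q => //.
exists (inr (exist _ p lt)), (inr (exist _ p' lt')); split=> //.
by move=> [].
Qed.
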